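(* Let $(Y_k)_{k\geqslant0}$ be a lazy simple symmetric random walk started at $Y_0=0$, with independent increments $Y_{k+1}-Y_k$ equal to $+1$ with probability $1/4$, $-1$ with probability $1/4$, and $0$ with probability $1/2$. Let $A_k=\sum_{i=1}^kY_i$, let \[ \tau=\inf\{k\geqslant1: Y_k=0,\ A_k\leqslant0\}, \] and let $\rho=\mathbb{P}(A_\tau=0)$. Then \[ \rho=1-e^{-2\omega},\qquad\text{where}\qquad \omega=\sum_{k=1}^\infty\frac{\mathcal{T}_k}{k4^k} \] and $\mathcal{T}_k$ is the number of rooted unlabeled (cyclically distinct) plane trees with $k$ edges.
   Context: $\mathcal{T}_n$ ($n\geqslant1$) is the number of unlabeled plane trees with $n$ edges and a distinguished root vertex, where two such trees are identified if there is a root-preserving isomorphism preserving the cyclic order of edges around each vertex (in particular the subtrees at the root are only ordered cyclically). By Walkup's formula, \[ \mathcal{T}_n=\frac1n\sum_{d\mid n}\binom{2d-1}{d}\phi(n/d), \] where $\phi$ is Euler's totient function. For example, $\mathcal{T}_1=1$, $\mathcal{T}_2=2$, $\mathcal{T}_3=4$. *)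

(* Defs.v *)
From HB Require Import structures.
From mathcomp Require Import all_boot all_order all_algebra all_fingroup finmap.
From mathcomp Require Import all_classical all_reals all_analysis.

Set Implicit Arguments.
Unset Strict Implicit.
Unset Printing Implicit Defensive.

Import Order.TTheory GRing.Theory Num.Theory.
Import numFieldNormedType.Exports.

Local Open Scope classical_set_scope.
Local Open Scope ring_scope.

(* A tree with n edges has n.+1 vertices, so a labelled one can be taken on
   'I_n.+1. In a simple graph the edges around v correspond to the neighbours
   of v, so the cyclic order of the edges around v is given by a successor
   permutation [rot v] of the set [nbr v]. *)
Record rooted_map (n : nat) := RootedMap {
  nbr : {ffun 'I_n.+1 -> {set 'I_n.+1}} ;
  rot : {ffun 'I_n.+1 -> {perm 'I_n.+1}} ;
  root_vertex : 'I_n.+1 }.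

Section RootedMapFinite.
Variable n : nat.

Definition rooted_map_code (G : rooted_map n) := (nbr G, rot G, root_vertex G).

Definition rooted_map_decode
    (x : {ffun 'I_n.+1 -> {set 'I_n.+1}} *
         {ffun 'I_n.+1 -> {perm 'I_n.+1}} * 'I_n.+1) :=
  RootedMap x.1.1 x.1.2 x.2.

Lemma rooted_map_codeK : cancel rooted_map_code rooted_map_decode.
Proof. by case. Qed.

HB.instance Definition _ :=
  Finite.copy (rooted_map n) (can_type rooted_map_codeK).

End RootedMapFinite.

Section PlaneTrees.
Variable n : nat.
Implicit Types (G H : rooted_map n) (u v w : 'I_n.+1).

Definition adj G : rel 'I_n.+1 := fun v w => w \in nbr G v.

(* The bound 2 is needed because [:: v; w] is a ucycle for every edge {v, w}. *)
Definition is_tree G : Prop :=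
  [/\ symmetric (adj G), irreflexive (adj G),
      forall v w, connect (adj G) v w &
      forall c : seq 'I_n.+1, ucycle (adj G) c -> (size c <= 2)%N].

(* [rot G v] restricts to a single cycle on [nbr G v]; it is normalised to be
   the identity elsewhere. *)
Definition is_rotation_system G : Prop :=
  forall v, perm_on (nbr G v) (rot G v) /\
            {in nbr G v, forall u, porbit (rot G v) u = nbr G v}.

Definition plane_trees : {set rooted_map n} :=
  [set G : rooted_map n | `[< is_tree G /\ is_rotation_system G >]]%SET.

Definition plane_iso : rel (rooted_map n) := fun G H =>
  [exists f : {perm 'I_n.+1},
    [&& f (root_vertex G) == root_vertex H,
        [forall v, nbr H (f v) == [set f w | w in nbr G v]%SET] &
        [forall v, forall w in nbr G v,
           rot H (f v) (f w) == f (rot G v w)]]].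

Definition num_plane_trees : nat :=
  #|equivalence_partition plane_iso plane_trees|.

End PlaneTrees.

Definition mutually_independent d (T : measurableType d) (R : realType)
    (P : probability T R) (X : nat -> T -> R) : Prop :=
  forall (J : {fset nat}) (B : nat -> set R),
    (forall i, measurable (B i)) ->
    P (\bigcap_(i in [set` J]) X i @^-1` B i) =
    (\prod_(i <- J) P (X i @^-1` B i))%E.

Section LazyWalk.
Context d (T : measurableType d) (R : realType) (P : probability T R).
Variable Y : nat -> {RV P >-> R}.

Definition increment (k : nat) (t : T) : R := Y k.+1 t - Y k t.

Definition lazy_simple_walk : Prop :=
  [/\ forall t, Y 0%N t = 0,
      mutually_independent P increment &
      forall k, [/\ P (increment k @^-1` [set 1]) = (1 / 4)%:E,
                    P (increment k @^-1` [set -1]) = (1 / 4)%:E &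
                    P (increment k @^-1` [set 0]) = (1 / 2)%:E]].

Definition area (k : nat) (t : T) : R := \sum_(1 <= i < k.+1) Y i t.

(* The value is +oo when the walk never meets the condition. *)
Definition tau (t : T) : \bar R :=
  ereal_inf [set (k%:R)%:E | k in
    [set k : nat | [/\ (1 <= k)%N, Y k t = 0 & area k t <= 0]]].

Definition area_tau_eq0 : set T :=
  [set t | exists2 k : nat, tau t = (k%:R)%:E & area k t = 0].

Definition rho : R := fine (P area_tau_eq0).

End LazyWalk.

(* The sum of the terms of index 1, ..., n. *)
Definition omega_partial (R : realType) (n : nat) : R :=
  \sum_(1 <= k < n.+1) (num_plane_trees k)%:R / (k%:R * 4 ^+ k).

Definition omega (R : realType) : R := limn (@omega_partial R).

(* Main.v *)
(** Cut the lazy walk at its returns to height 0 with area 0. A path of length k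
    that ends in such a return and whose area is nonnegative at every zero is
    uniquely a concatenation of paths counted by [rho], so those with m returns
    have total weight [rho ^ m], and
      - ln (1 - rho) = sum_m rho ^ m / m = sum_k 4 ^ -k sum_path 1 / returns.
    By a cycle lemma the inner sum is (1 / k) times the number of bridges of
    length k whose area is divisible by k: among the rotations of such a bridge,
    start at the average height and at the least corrected area. Roots of unity
    evaluate k times this number as sum_(j < k) 'C(2 gcd(j, k), gcd(j, k)), which
    by Burnside is also 2 k times the number of balanced binary words of length
    2 k up to rotation. Finally, reading the contour of a plane tree as ups and
    downs identifies these classes with the rooted plane trees with k edges. *)

From HB Require Import structures.
From mathcomp Require Import all_boot all_order all_algebra all_fingroup.
From mathcomp Require Import algC cyclotomic zify ring lra.

Set Implicit Arguments.
Unset Strict Implicit.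
Unset Printing Implicit Defensive.

Import Order.TTheory GRing.Theory Num.Theory.

(** * Necklaces *)

(** A lazy step is a sum of two fair bits minus 1, which turns probabilities into counts: every
    sequence of k pairs of bits has weight 4 ^ -k. The cycle lemma has to cope with periodic paths,
    whose rotations are not all distinct. Rotations are therefore counted by starting index, with
    multiplicity; all good rotations of one path then have the same number of returns, namely the
    number of good starting indices, and dividing by it makes the count exact. The contour word of a
    tree has no preferred start, just as the subtrees at the root have no first one. The root is
    still recovered from the cyclic word, as its lowest level, so rotation classes rather than words
    correspond to trees. Words have length 2 k while residues are taken modulo k. Rotations by an
    odd amount fix no balanced word, so Burnside leaves the same gcd sum, and the ratio 2 between
    the two counts becomes the 2 in the exponent. Series are rearranged in the extended reals, where
    all terms are nonnegative. The logarithm needs [rho < 1], which is read off the path -1, +1. *)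

Section Rotation.
Variable m : nat.
Implicit Types (w : {ffun 'I_m.+1 -> bool}) (g : 'I_m.+1).

Definition rot_word w g : {ffun 'I_m.+1 -> bool} := [ffun x => w (x + g)%R].

Lemma rot_word_is_action : is_action [set: 'I_m.+1] rot_word.
Proof.
split=> [g w w' E|w g g' _ _]; apply/ffunP => x.
  by have /ffunP/(_ (x - g)%R) := E; rewrite !ffunE subrK.
by rewrite !ffunE -addrA; congr (w _); congr (x + _)%R; rewrite addrC.
Qed.

Canonical rot_word_action := Action rot_word_is_action.

End Rotation.

(** The length 2 (n' + 1) is written as a successor so that the indices carry addition modulo the
    length. *)
Definition balanced n' : {set {ffun 'I_n'.*2.+2 -> bool}} :=
  [set w : {ffun 'I_n'.*2.+2 -> bool} | #|[set i | w i]| == n'.+1].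

Lemma big_ord_modn (R : Type) (idx : R) (op : Monoid.com_law idx) a e (f : nat -> R) :
  \big[op/idx]_(x < a * e) f (x %% e) =
  \big[op/idx]_(i < a) \big[op/idx]_(x < e) f x.
Proof.
have E m (g : nat -> R) :
    \big[op/idx]_(x < m) g x = \big[op/idx]_(0 <= x < m) g x by rewrite big_mkord.
elim: a => [|a IH]; first by rewrite mul0n !big_ord0.
rewrite big_ord_recl /= -IH !(E _ (fun x => f (x %% e))) (E _ f).
rewrite mulSn (@big_cat_nat _ _ _ e) ?leq_addr //=.
apply: f_equal2; first by apply: eq_big_nat => x /andP[_ xe]; rewrite modn_small.
rewrite -{1}[e]add0n big_addn addKn; apply: eq_bigr => x _.
by rewrite modnDr.
Qed.

Lemma sum_ord_even k (f : nat -> nat) : (forall i, odd i -> f i = 0) ->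
  \sum_(x < k.*2) f x = \sum_(x < k) f x.*2.
Proof.
move=> f0; elim: k => [|k IH]; first by rewrite !big_ord0.
by rewrite doubleS !big_ord_recr /= IH [f _.+1]f0 ?addn0 //= odd_double.
Qed.

Lemma card_half_words e :
  #|[set u : {ffun 'I_e -> bool} | #|[set i | u i]|.*2 == e]| =
  if odd e then 0 else 'C(e, e./2).
Proof.
case: ifP => [oe|/negbT oe].
  apply/eqP; rewrite cards_eq0; apply/eqP/setP => u; rewrite !inE.
  by apply/eqP => E; rewrite -E odd_double in oe.
have := card_draws 'I_e e./2; rewrite card_ord => <-.
rewrite -(card_in_imset (f := fun u : {ffun 'I_e -> bool} => [set i | u i])); last first.
  by move=> u v _ _ /setP E; apply/ffunP => i; have := E i; rewrite !inE.
apply: eq_card => A; rewrite !inE; apply/imsetP/eqP => [[u]|E].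
  by rewrite inE => /eqP uE ->; rewrite -(half_bit_double #|_| false) add0n uE.
exists [ffun i => i \in A].
  rewrite inE (_ : [set i | _] = A); last by apply/setP => i; rewrite !inE ffunE.
  by rewrite E; lia.
by apply/setP => i; rewrite !inE ffunE.
Qed.

Section Fixed.
Variable n' : nat.
Local Notation M := n'.*2.+2.
Local Notation word := {ffun 'I_M -> bool}.

Lemma rot_wordE (w : word) (g : 'I_M) (x : nat) : rot_word w g (inZp x) = w (inZp (x + g)).
Proof. by rewrite ffunE; congr (w _); apply: val_inj; rewrite /= modnDml. Qed.

(** By Bezout the gcd is a multiple of [g] up to a multiple of the length, so invariance under the
    shift by [g] is periodicity with period the gcd. *)
Lemma rot_word_fixP (w : word) (g : 'I_M) : rot_word w g = w <->
  forall x, w (inZp x) = w (inZp (x %% gcdn g M)).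
Proof.
set e := gcdn g M; have eM : e %| M by apply: dvdn_gcdr.
split=> [E x|E].
  have per k y : w (inZp (y + k * g)) = w (inZp y).
    elim: k => [|k IH]; first by rewrite addn0.
    by rewrite mulSn addnCA addnC -rot_wordE E.
  have perM k y : w (inZp (y + k * M)) = w (inZp y).
    by congr (w _); apply: val_inj; rewrite /= addnC modnMDl.
  have pere y : w (inZp (y + e)) = w (inZp y).
    have [g0|g0] := posnP (nat_of_ord g).
      by have := perM 1 y; rewrite mul1n /e g0 gcd0n.
    have [km kn Ee _] := egcdnP M g0.
    by rewrite -(perM kn) -addnA [e + _]addnC /e -Ee per.
  rewrite {1}(divn_eq x e) addnC; elim: (x %/ e) => [|k IH]; first by rewrite addn0.
  by rewrite mulSn addnCA addnC pere.
apply/ffunP => x; rewrite -[x]valZpK rot_wordE E [RHS]E; congr (w (inZp _)).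
have eg : e %| g by apply: dvdn_gcdl.
by rewrite -modnDmr (eqP eg) addn0.
Qed.

(** A fixed word repeats its first [e] letters, [e] being the gcd, and is balanced exactly when this
    block is; a block of odd length never is. *)
Lemma card_fixed (g : 'I_M) :
  #|('Fix_(balanced n' | rot_word_action _)[g])%g| =
  if odd (gcdn g M) then 0 else 'C(gcdn g M, (gcdn g M)./2).
Proof.
set e := gcdn g M; have eM : e %| M by apply: dvdn_gcdr.
have e0 : 0 < e by rewrite gcdn_gt0 orbT.
have eleM : e <= M by apply: dvdn_leq.
rewrite -card_half_words.
pose ext (u : {ffun 'I_e -> bool}) : word := [ffun x : 'I_M => u (Ordinal (ltn_pmod x e0))].
have card_ext u : #|[set i | ext u i]| = M %/ e * #|[set i | u i]|.
  pose f k := nat_of_bool (u (Ordinal (ltn_pmod k e0))).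
  transitivity (\sum_(x < M) f (x %% e)).
    rewrite -sum1_card big_mkcond /=; apply: eq_bigr => x _; rewrite inE ffunE /f.
    rewrite (_ : Ordinal (ltn_pmod (x %% e) e0) = Ordinal (ltn_pmod x e0)).
      by case: (u _).
    by apply: val_inj; rewrite /= modn_mod.
  rewrite -[in LHS](divnK eM) (big_ord_modn _ _ _ f) sum_nat_const card_ord.
  congr (_ * _).
  rewrite -sum1_card [RHS]big_mkcond /=; apply: eq_bigr => x _; rewrite inE /f.
  rewrite (_ : Ordinal (ltn_pmod x e0) = x); first by case: (u x).
  by apply: val_inj; rewrite /= modn_small.
rewrite -(card_in_imset (f := ext)); last first.
  move=> u v _ _ /ffunP E; apply/ffunP => i.
  have := E (widen_ord eleM i); rewrite !ffunE.
  by rewrite (_ : Ordinal _ = i) //; apply: val_inj; rewrite /= modn_small.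
apply: eq_card => w; rewrite in_setI; apply/andP/imsetP.
  rewrite {1}inE => -[/eqP wb /afix1P/rot_word_fixP per]; rewrite -/e in per.
  pose u := [ffun i : 'I_e => w (widen_ord eleM i)].
  have wE : w = ext u.
    apply/ffunP => x; rewrite !ffunE -[x in LHS]valZpK per; congr (w _).
    by apply: val_inj; rewrite /= modn_small // (leq_trans (ltn_pmod _ e0)).
  exists u => //; rewrite inE; apply/eqP.
  have q0 : 0 < M %/ e by rewrite divn_gt0.
  apply/eqP; rewrite -(eqn_pmul2l q0) -doubleMr -card_ext -wE wb divnK //.
move=> [u]; rewrite inE => /eqP ue ->; split.
  rewrite inE card_ext -(eqn_pmul2l (ltn0Sn 1)) !mul2n doubleMr ue divnK //.
apply/afix1P; apply/rot_word_fixP => x; rewrite -/e !ffunE; congr (u _).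
apply: val_inj; rewrite /= modn_dvdm // [in RHS]modn_dvdm // modn_mod //.
Qed.

(** Burnside's count. An odd rotation has an odd gcd with the even length and contributes nothing;
    an even one, 2 j, has gcd twice [gcdn j n'.+1]. *)
Lemma card_orbits :
  #|orbit (rot_word_action _) [set: 'I_M] @: balanced n'| * n'.+1.*2 =
  \sum_(j < n'.+1) 'C((gcdn j n'.+1).*2, gcdn j n'.+1).
Proof.
have acts : [acts [set: 'I_M], on balanced n' | rot_word_action _].
  apply/subsetP => g _; rewrite inE /=; apply/andP; split; first by rewrite inE.
  rewrite inE; apply/subsetP => w; rewrite !inE => /eqP <-; apply/eqP.
  rewrite -[RHS](card_imset _ (@addIr _ (- g)%R)); apply: eq_card => i.
  rewrite !inE ffunE; apply/idP/imsetP => [wi|[x]].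
    by exists (i + g)%R; rewrite ?inE // addrK.
  by rewrite inE => wx ->; rewrite subrK.
have := Frobenius_Cauchy acts; rewrite cardsT card_ord => /esym E; apply: etrans E _.
pose f j := if odd (gcdn j M) then 0 else 'C(gcdn j M, (gcdn j M)./2).
transitivity (\sum_(j < n'.+1.*2) f j).
  by apply: eq_big => [j|j _]; rewrite ?inE // card_fixed.
rewrite sum_ord_even; last first.
  move=> i oi; rewrite /f; case: ifP => // /negbT; rewrite (dvdn_odd _ oi) //.
  exact: dvdn_gcdl.
apply: eq_bigr => j _; rewrite /f -[M]/(n'.+1.*2) -!mul2n -muln_gcdr mul2n.
by rewrite odd_double doubleK.
Qed.

End Fixed.

(** * Contours of plane trees *)

Section RootedTree.
Variables (V : finType) (e : rel V) (r : V).

(** This is the form in which the contour arguments use connectedness and acyclicity: every edge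
    joins a vertex to its parent. The value of [p] at the root is left free. *)
Definition parent_depth (p : V -> V) (h : V -> nat) :=
  [/\ h r = 0,
      forall v, v != r -> e v (p v) /\ h v = (h (p v)).+1 &
      forall v w, e v w -> v != r /\ w = p v \/ w != r /\ v = p w].

Hypothesis esym : symmetric e.

Lemma parent_depth_step p h v w : parent_depth p h -> e v w ->
  h w = (h v).+1 \/ h v = (h w).+1.
Proof.
by move=> [_ hp he] /he[[/hp[_ ->] ->]|[/hp[_ ->] ->]]; [right|left].
Qed.

(** Along the parents [p'] down to the root, [h'] drops by exactly 1 at each step, while [h] changes
    by only 1. *)
Lemma parent_depth_le p h p' h' : parent_depth p h -> parent_depth p' h' ->
  forall v, h v <= h' v.
Proof.
move=> H [h0' hp' _] v; have [m] := ubnP (h' v); elim: m v => // m IH v hm.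
have [->|vr] := eqVneq v r; first by case: H => ->.
have [e1 E1] := hp' _ vr; have := parent_depth_step H e1.
have := IH (p' v); lia.
Qed.

Lemma parent_depth_uniq p h p' h' : parent_depth p h -> parent_depth p' h' -> h =1 h'.
Proof.
move=> H H' v; apply/eqP; rewrite eqn_leq.
by rewrite (parent_depth_le H H') (parent_depth_le H' H).
Qed.

Hypothesis eirr : irreflexive e.
Hypothesis econn : forall v w, connect e v w.
Hypothesis eacyc : forall c, ucycle e c -> size c <= 2.

Let avoid v : rel V := fun x y => [&& e x y, x != v & y != v].

Let avoid_path v x s : path (avoid v) x s -> path e x s /\ v \notin s.
Proof.
elim: s x => //= y s IH x /andP[/and3P[exy xv yv] /IH[-> vs]].
by split; rewrite ?andbT // inE negb_or eq_sym yv vs.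
Qed.

Let path_avoid v x s : path e x s -> v \notin x :: s -> path (avoid v) x s.
Proof.
elim: s x => //= y s IH x /andP[exy ps]; rewrite !inE !negb_or => /and3P[vx vy vs].
by rewrite IH ?inE ?negb_or ?vy // /avoid exy eq_sym vx eq_sym vy.
Qed.

(** A simple path from x to another neighbour of v, avoiding v, would close up through v into a
    cycle of length at least 3. *)
Lemma neighbours_separated v x y :
  e v x -> e v y -> connect (avoid v) x y -> x = y.
Proof.
move=> evx evy /connectP[s0 ps0 E]; move: evy; rewrite {}E {y}.
case/shortenP: ps0 => s ps us _ evy.
have [pes vs] := avoid_path ps.
case: s ps us evy pes vs => // z s ps us evy pes vs.
have vx : v != x by apply: contraTneq evx => <-; rewrite eirr.
have : ucycle e (v :: x :: z :: s).
  apply/andP; split; last by rewrite [uniq _]/= inE negb_or vx vs.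
  rewrite [path.cycle _ _]/= evx rcons_path; move: pes => /= /andP[-> ->] /=.
  by rewrite esym.
by move/eacyc.
Qed.

(* In a tree exactly one neighbour of v reaches the root without passing through v. *)
Let parent v := odflt v [pick w | e v w && connect (avoid v) w r].

Let parentP v : v != r -> e v (parent v) /\ connect (avoid v) (parent v) r.
Proof.
move=> vr; rewrite /parent; case: pickP => [w /andP[]//|no].
have /connectP[s0 ps0 E] := econn v r.
case/shortenP: ps0 E => -[|w s] /= ps us _ E; first by rewrite E eqxx in vr.
case/andP: ps us => evw ps /andP[vs us].
have := no w; rewrite evw /= => /connectP[]; exists s => //.
exact: path_avoid.
Qed.

Let parentE v w : v != r -> e v w -> connect (avoid v) w r -> w = parent v.
Proof.
move=> vr evw cw; have [evp cp] := parentP vr.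
apply: (neighbours_separated evw evp); apply: connect_trans cw _.
rewrite (@sym_connect_sym _ (avoid v)) // => a b /=.
by rewrite /avoid esym; congr (_ && _); rewrite andbC.
Qed.

Let has_path v k := [exists s : k.-tuple V, path e v s && (last v s == r)].

Let has_pathP v k : reflect (exists s, [/\ path e v s, last v s = r & size s = k]) (has_path v k).
Proof.
apply: (iffP existsP) => [[s /andP[ps /eqP ls]]|[s [ps ls /eqP ss]]].
  by exists s; rewrite size_tuple.
by exists (Tuple ss); rewrite /= ps ls eqxx.
Qed.

Let has_path_ex v : exists k, has_path v k.
Proof.
have /connectP[s ps E] := econn v r; exists (size s).
by apply/has_pathP; exists s.
Qed.

Let dist v := ex_minn (has_path_ex v).

(** A path to the root, once made simple, leaves v for good after its first step, and [parent v] is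
    the only neighbour from which that is possible. *)
Let dist_parent v : v != r -> dist v = (dist (parent v)).+1.
Proof.
move=> vr; have [evp _] := parentP vr; apply/eqP; rewrite eqn_leq; apply/andP; split.
  rewrite /dist; case: ex_minnP => k _ kmin; case: ex_minnP => l /has_pathP[s [ps ls <-]] _.
  apply: kmin; apply/has_pathP; exists (parent v :: s); split => //=.
  by rewrite evp.
rewrite /dist; case: ex_minnP => k kP kmin; case: ex_minnP => l /has_pathP[s0 [ps0 ls0 <-]] lmin.
case/shortenP: ps0 ls0 => -[|w s] ps us ss E; first by rewrite -E eqxx in vr.
case/andP: ps us => evw ps /andP[vs us].
have pw : w = parent v.
  apply: parentE => //; apply/connectP; exists s => //; exact: path_avoid.
have : k <= size s by apply: kmin; apply/has_pathP; exists s; split => //; rewrite -pw.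
by move=> ks; apply: leq_trans (@uniq_leq_size _ (w :: s) s0 us ss).
Qed.

(** The route from v through [parent v] to the root avoids w: otherwise w would itself reach the
    root without v and be the parent of v. So v is the neighbour of w on the root side. *)
Let parent_edge v w : e v w -> v != r -> w != parent v -> w != r /\ v = parent w.
Proof.
move=> evw vr wp; have [evp cp] := parentP vr.
have wr : w != r.
  by apply: contraNneq wp => wr; apply/eqP/parentE; rewrite ?wr // -?wr.
split=> //; apply: parentE; rewrite // 1?esym //.
case/connectP: cp => s ps rs.
have [pe vs] := avoid_path ps.
apply/connectP; exists (parent v :: s) => //=.
have vw : v != w by apply: contraTneq evw => <-; rewrite eirr.
apply: (@path_avoid w v (parent v :: s)); first by rewrite /= evp.
rewrite !inE !negb_or eq_sym vw wp /=; apply/negP => ws.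
case/splitPr: ws ps rs => s1 s2; rewrite cat_path last_cat => /andP[_ ps] rs.
case/negP: wp; apply/eqP/parentE => //; apply/connectP.
by exists s2 => //; case/andP: ps.
Qed.

Lemma tree_parent_depth : exists p h, parent_depth p h.
Proof.
exists parent, dist; split.
- rewrite /dist; case: ex_minnP => k _ /(_ 0) kmin.
  by apply/eqP; rewrite -leqn0; apply: kmin; apply/has_pathP; exists [::].
- by move=> v vr; split; [case: (parentP vr)|exact: dist_parent].
move=> v w evw; have [vr|vr] := eqVneq v r.
  right; have wr : w != r by apply: contraTneq evw => ->; rewrite vr eirr.
  by split=> //; apply: parentE; rewrite // 1?esym // vr connect0.
have [->|wp] := eqVneq w (parent v); first by left.
by right; apply: parent_edge.
Qed.

End RootedTree.

(** * The walk around a tree given by a rotation system *)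

Section Contour.
Variables (V : finType) (r : V) (nb : V -> {set V}) (rt : V -> {perm V}).

Definition dart : pred (V * V) := fun x => x.2 \in nb x.1.
Definition rotation_system := forall v, perm_on (nb v) (rt v) /\
  {in nb v, forall u, porbit (rt v) u = nb v}.
(* Directed edges (v, w); iterating this step walks around the tree. *)
Definition contour_step (x : V * V) := (x.2, rt x.2 x.1).
Definition dart_rev (x : V * V) := (x.2, x.1).

Local Notation phi := contour_step.

Variables (p : V -> V) (h : V -> nat).
Hypothesis nbsym : symmetric (fun v w => w \in nb v).
Hypothesis nbrot : rotation_system.
Hypothesis pd : parent_depth (fun v w => w \in nb v) r p h.

Definition ascending : pred (V * V) := fun x => h x.1 < h x.2.

Lemma contour_step_inj : injective phi.
Proof. by move=> [a b] [c d] [<-] /perm_inj <-. Qed.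

Lemma rot_nb v u : u \in nb v -> rt v u \in nb v.
Proof.
by move=> uv; have [_ /(_ u uv) <-] := nbrot v; rewrite (mem_porbit (rt v) 1).
Qed.

Lemma dart_step x : dart x -> dart (phi x).
Proof. by rewrite /dart /= => xd; apply: rot_nb; rewrite nbsym. Qed.

Lemma dart_iter x i : dart x -> dart (iter i phi x).
Proof. by move=> xd; elim: i => //= i; apply: dart_step. Qed.

Lemma dart_rev_dart x : dart x -> dart (dart_rev x).
Proof. by rewrite /dart /= nbsym. Qed.

Lemma depth_root v : (h v == 0) = (v == r).
Proof.
case: pd => h0 hp _; have [->|/hp[_ ->]//] := eqVneq v r.
by rewrite h0.
Qed.

Lemma depth_dart x : dart x -> h x.2 = (h x.1).+1 \/ h x.1 = (h x.2).+1.
Proof. by move=> xd; apply: (parent_depth_step pd). Qed.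

Lemma ascending_rev x : dart x -> ascending (dart_rev x) = ~~ ascending x.
Proof. by rewrite /ascending /= => /depth_dart[] ->; lia. Qed.

Lemma ascendingE x : dart x -> ascending x = (x.2 != r) && (x.1 == p x.2).
Proof.
case: pd => h0 hp he xd; rewrite /ascending; case: x xd => v w /= xd.
have [[vr E]|[wr E]] := he v w xd.
  have [_ hv] := hp v vr; rewrite E hv ltnNge leqnSn.
  have [//|wr] /= := eqVneq (p v) r.
  apply/esym/eqP => E'; have [_] := hp _ wr; rewrite -E' hv; lia.
by have [_ ->] := hp w wr; rewrite -E wr eqxx ltnSn.
Qed.

Definition reach_above c x y :=
  exists k, iter k phi x = y /\ forall i, i <= k -> c <= h (iter i phi x).1.

Lemma reach_above_refl c x : c <= h x.1 -> reach_above c x x.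
Proof. by exists 0; split=> // i; rewrite leqn0 => /eqP->. Qed.

Lemma reach_above_trans c x y z :
  reach_above c x y -> reach_above c y z -> reach_above c x z.
Proof.
move=> [k [E H]] [l [F H']]; exists (l + k); split; first by rewrite iterD E.
move=> i il; have [/H//|ki] := leqP i k.
by rewrite -(subnK (ltnW ki)) iterD E; apply: H'; lia.
Qed.

Lemma reach_above_step c x : c <= h x.1 -> c <= h x.2 -> reach_above c x (phi x).
Proof. by move=> h1 h2; exists 1; split=> // -[|[|]]. Qed.

Lemma reach_above_weak c c' x y : c' <= c -> reach_above c x y -> reach_above c' x y.
Proof.
by move=> cc [k [E H]]; exists k; split=> // i /H; apply: leq_trans.
Qed.

(** Induction from the deepest level [M] downwards. Turning around w from just after [p w], each
    neighbour met before [p w] is a child u; its subtree is walked by induction, ending with the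
    dart from u to w, and the next step leaves w towards the following neighbour. *)
Lemma reach_parent w : w != r -> reach_above (h w) (w, rt w (p w)) (w, p w).
Proof.
have [M hM] : exists M, forall v, h v <= M.
  by exists (\max_v h v) => v; apply: (@leq_bigmax _ h v).
have [m] := ubnP (M - h w); elim: m w => // m IH w hm wr.
case: pd => h0 hp he; have [wp hwp] := hp w wr.
have next u : u \in nb w -> u != p w -> reach_above (h w) (w, u) (w, rt w u).
  move=> uw up; have [[_ E]|[ur E]] := he w u uw; first by rewrite E eqxx in up.
  have [_ hu] := hp u ur.
  apply: (@reach_above_trans _ _ (phi (w, u))).
    by apply: reach_above_step => //=; rewrite hu E.
  apply: (@reach_above_trans _ _ (u, w)).
    apply: (@reach_above_weak (h u)); first by rewrite hu E.
    rewrite /phi /= E; apply: IH => //.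
    by move: (hM u) hm; rewrite hu -E; lia.
  by rewrite -[(w, rt w u)]/(phi (u, w)); apply: reach_above_step => //=; rewrite hu E.
have : p w \in porbit (rt w) (rt w (p w)).
  by rewrite porbit_sym (mem_porbit (rt w) 1).
move/porbitP=> [i]; rewrite permX.
have : rt w (p w) \in nb w by apply: rot_nb.
elim: i (rt w (p w)) => [|i IHi] u uw E; first by rewrite E; apply: reach_above_refl.
have [->|up] := eqVneq u (p w); first exact: reach_above_refl.
apply: reach_above_trans (next u uw up) _.
by apply: IHi; [exact: rot_nb|rewrite -iterSr].
Qed.

(* The walk traverses the whole subtree above an ascending edge before coming
   back along it: the reversed edge is the first descent below depth [h x.2]. *)
Lemma reach_rev x : dart x -> ascending x ->
  exists k, iter k.+1 phi x = dart_rev x /\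
    forall i, 0 < i <= k.+1 -> h x.2 <= h (iter i phi x).1.
Proof.
move=> xd; rewrite ascendingE // => /andP[wr /eqP E]; case: x E wr xd => v w /= -> wr xd.
have [k [E H]] := reach_parent wr; exists k; split.
  by rewrite -iterS iterSr /= /phi /= E.
by case=> // i /andP[_ ik]; rewrite iterSr; apply: H.
Qed.

Lemma fconnect_rev x : dart x -> fconnect phi x (dart_rev x).
Proof.
move=> xd; have xr := dart_rev_dart xd.
wlog up : x xd xr / ascending x.
  move=> W; have [/W->//|] := boolP (ascending x).
  rewrite -ascending_rev // => ur; have := W _ xr xd ur.
  by case: x {xd xr ur} => a b; rewrite fconnect_sym //; apply: contour_step_inj.
by have [k [<- _]] := reach_rev xd up; apply: fconnect_iter.
Qed.

(** Reversing a dart and then making a contour step is one turn around its source, and the turns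
    around a vertex reach all its neighbours. *)
Lemma fconnect_same_source x y : dart x -> dart y -> x.1 = y.1 -> fconnect phi x y.
Proof.
case: x => v w; case: y => v' w'; rewrite /dart /= => vw vw' E; subst v'.
have : w' \in porbit (rt v) w by case: (nbrot v) => _ ->.
case/porbitP=> i ->{w' vw'}; rewrite permX; elim: i => [|i IH] //=.
apply: connect_trans IH _.
have d1 : dart (v, iter i (rt v) w) by elim: i => //= i; apply: rot_nb.
apply: connect_trans (fconnect_rev d1) _.
by rewrite -[(v, rt _ _)]/(phi (dart_rev (v, iter i (rt v) w))); apply: fconnect1.
Qed.

(** A tree drawn in the plane has a single face. Any dart is joined to one leaving the root by going
    to the parent repeatedly. *)
Lemma fconnect_darts x y : dart x -> dart y -> fconnect phi x y.
Proof.
have fsym := fconnect_sym contour_step_inj.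
case: pd => h0 hp he.
have toroot z : dart z -> exists2 z', dart z' & z'.1 = r /\ fconnect phi z z'.
  have [m] := ubnP (h z.1); elim: m z => // m IH z hm zd.
  have [zr|zr] := eqVneq z.1 r; first by exists z.
  have [zp zh] := hp _ zr.
  have d1 : dart (z.1, p z.1) by [].
  have [||z' zd' [zr' c']] := IH (p z.1, z.1); first by rewrite /=; lia.
    exact: (dart_rev_dart d1).
  exists z' => //; split => //; apply: connect_trans c'.
  apply: connect_trans (fconnect_same_source zd d1 _) _ => //.
  exact: (fconnect_rev d1).
move=> /toroot[x' xd [xr cx]] /toroot[y' yd [yr cy]].
apply: connect_trans cx _; rewrite fsym; apply: connect_trans cy _.
by apply: fconnect_same_source; rewrite // xr yr.
Qed.

Lemma fconnect_dart x y : dart x -> fconnect phi x y = dart y.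
Proof.
move=> xd; apply/idP/idP; last exact: fconnect_darts.
by case/connectP=> s /fpathP[n ->] ->; rewrite last_traject; apply: dart_iter.
Qed.

(** Each vertex other than the root is entered by one ascending dart, the one from its parent. *)
Lemma card_ascending : #|[set x | dart x && ascending x]| = #|V|.-1.
Proof.
transitivity #|[set (p v, v) | v in [set~ r]]|; last first.
  by rewrite card_imset ?cardsC1 // => a b [].
apply: eq_card => -[a b]; rewrite !inE; case: pd => h0 hp he.
apply/andP/imsetP => [[d]|[v]].
  by rewrite ascendingE //= => /andP[br /eqP->]; exists b; rewrite ?inE.
rewrite !inE => vr [-> ->]; have [pv _] := hp v vr.
have d : dart (p v, v) by rewrite /dart /= nbsym.
by split; rewrite // ascendingE //= vr eqxx.
Qed.

Lemma card_darts : #|[set x | dart x]| = (#|V|.-1).*2.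
Proof.
rewrite -(cardsID [set x | ascending x]) -addnn; congr (_ + _).
  rewrite -card_ascending; apply: eq_card => x; by rewrite !inE.
rewrite -card_ascending -[RHS](card_imset _ (f := dart_rev)); last first.
  by move=> [a b] [c d] [-> ->].
apply: eq_card => x; rewrite !inE; apply/andP/imsetP => [[nx xd]|[y]].
  exists (dart_rev x); last by case: x {nx xd}.
  by rewrite inE dart_rev_dart //= ascending_rev.
rewrite inE => /andP[yd ya] ->; have yr := dart_rev_dart yd; split => //.
by rewrite ascending_rev // ya.
Qed.

Lemma order_dart x : dart x -> fingraph.order phi x = (#|V|.-1).*2.
Proof.
move=> xd; rewrite /fingraph.order -card_darts; apply: eq_card => y.
by rewrite inE -(fconnect_dart _ xd).
Qed.

Lemma dart_at v : 1 < #|V| -> exists w, dart (v, w).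
Proof.
case: pd => h0 hp he V1; have [->|vr] := eqVneq v r; last by exists (p v); case: (hp v vr).
have [u ur] : exists u, u != r.
  have : 0 < #|[set~ r]| by rewrite cardsC1; case: #|V| V1 => [|[]].
  by case/card_gt0P=> u; rewrite !inE; exists u.
have [m] := ubnP (h u); elim: m u ur => // m IH u ur hm.
have [pu hu] := hp u ur.
have [E|pr] := eqVneq (p u) r; first by exists u; rewrite /dart /= nbsym -E.
by apply: (IH (p u)) => //; lia.
Qed.

(** Depth moves by +1 or -1, written without subtraction to stay in [nat]. *)
Lemma depth_iter x i : dart x ->
  h (iter i.+1 phi x).1 + ~~ ascending (iter i phi x) =
  h (iter i phi x).1 + ascending (iter i phi x).
Proof.
move=> /(dart_iter i); rewrite iterS; set y := iter i phi x => yd /=.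
by rewrite /ascending; case: (depth_dart yd) => ->; lia.
Qed.

End Contour.

(** * The contour word determines the rooted plane tree *)

Section SameWord.
Variable V : finType.
Hypothesis V1 : 1 < #|V|.
Local Notation N := (#|V|.-1).*2.

Definition plane_tree_with (r : V) (nb : V -> {set V}) (rt : V -> {perm V}) (h : V -> nat) :=
  [/\ symmetric (fun v w => w \in nb v), rotation_system nb rt &
      exists p, parent_depth (fun v w => w \in nb v) r p h].

Lemma iter_contour_mod r nb rt h d i : plane_tree_with r nb rt h -> dart nb d ->
  iter i (contour_step rt) d = iter (i %% N) (contour_step rt) d.
Proof.
move=> [nbsym nbrot [p pd]] dd; rewrite {1}(divn_eq i N) addnC iterD; congr (iter _ _ _).
elim: (i %/ N) => // k IH; rewrite mulSn iterD IH.
rewrite -[in LHS](order_dart nbsym nbrot pd dd) iter_order //; exact: contour_step_inj.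
Qed.

Section Two.
Variables (r r' : V) (nb nb' : V -> {set V}) (rt rt' : V -> {perm V}) (h h' : V -> nat).
Hypothesis T : plane_tree_with r nb rt h.
Hypothesis T' : plane_tree_with r' nb' rt' h'.
Variables d d' : V * V.
Hypothesis dd : dart nb d.
Hypothesis dd' : dart nb' d'.
Local Notation phi := (contour_step rt).
Local Notation phi' := (contour_step rt').
Hypothesis same_word : forall i, i < N ->
  ascending h (iter i phi d) = ascending h' (iter i phi' d').

Let N0 : 0 < N. Proof. by move: V1; lia. Qed.

Lemma same_wordE i : ascending h (iter i phi d) = ascending h' (iter i phi' d').
Proof.
by rewrite (iter_contour_mod _ T dd) (iter_contour_mod _ T' dd') same_word // ltn_mod.
Qed.

(** Equal words make the two depths differ by a constant along the contours. *)
Lemma depth_offset i :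
  h (iter i phi d).1 + h' d'.1 = h' (iter i phi' d').1 + h d.1.
Proof.
case: T => s R [p pd]; case: T' => s' R' [p' pd'].
elim: i => [|i IH]; first by rewrite addnC.
have := depth_iter s R pd i dd; have := depth_iter s' R' pd' i dd'.
rewrite same_wordE; set a := ascending _ _; move: IH.
by case: a => /=; lia.
Qed.

Lemma dart_reached x : dart nb x -> exists i, x = iter i phi d.
Proof.
case: T => s R [p pd] dx; exists (findex phi d x).
by rewrite iter_findex // (fconnect_darts s R pd).
Qed.

(** Evaluate the constant offset when the first contour stands at its root, at depth 0. With the
    roles exchanged this gives equality: both contours reach their roots at the lowest level of the
    common word. *)
Lemma depth_source_le : h d.1 <= h' d'.1.
Proof.
case: T => s R [p pd].
have [w rw] := dart_at s pd r V1.
have [i E] := dart_reached rw.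
have := depth_offset i; rewrite -E /=.
have /eqP -> : h r == 0 by rewrite (depth_root pd).
by lia.
Qed.

End Two.

Section Iso.
Variables (r r' : V) (nb nb' : V -> {set V}) (rt rt' : V -> {perm V}) (h h' : V -> nat).
Hypothesis T : plane_tree_with r nb rt h.
Hypothesis T' : plane_tree_with r' nb' rt' h'.
Variables d d' : V * V.
Hypothesis dd : dart nb d.
Hypothesis dd' : dart nb' d'.
Local Notation phi := (contour_step rt).
Local Notation phi' := (contour_step rt').
Hypothesis same_word : forall i, i < N ->
  ascending h (iter i phi d) = ascending h' (iter i phi' d').

Lemma depth_source i : h (iter i phi d).1 = h' (iter i phi' d').1.
Proof.
have W : forall i, i < N -> ascending h' (iter i phi' d') = ascending h (iter i phi d).
  by move=> j jN; rewrite same_word.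
have := depth_source_le T T' dd dd' same_word.
have := depth_source_le T' T dd' dd W.
by have := depth_offset T T' dd dd' same_word i; lia.
Qed.

(** Sends a dart of the first tree to the dart met at the same time on the second contour. *)
Definition transfer x := iter (findex phi d x) phi' d'.

Let N0 : 0 < N. Proof. by move: V1; lia. Qed.

Lemma transfer_iter i : transfer (iter i phi d) = iter i phi' d'.
Proof.
rewrite /transfer (iter_contour_mod _ T dd) findex_iter.
  by rewrite -(iter_contour_mod _ T' dd').
by case: T => s R [p pd]; rewrite (order_dart s R pd dd) ltn_mod.
Qed.

Let reached x : dart nb x -> exists i, x = iter i phi d.
Proof. exact: (dart_reached T dd). Qed.

Lemma transfer_dart x : dart nb' (transfer x).
Proof. by case: T' => s R _; apply: dart_iter. Qed.

Lemma transfer_step x : dart nb x -> transfer (phi x) = phi' (transfer x).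
Proof. by move=> /reached[i ->]; rewrite -iterS !transfer_iter. Qed.

Lemma transfer_iter_step k x : dart nb x ->
  transfer (iter k phi x) = iter k phi' (transfer x).
Proof. by move=> /reached[i ->]; rewrite -iterD !transfer_iter iterD. Qed.

Lemma transfer_depth x : dart nb x -> h' (transfer x).1 = h x.1.
Proof. by move=> /reached[i ->]; rewrite transfer_iter depth_source. Qed.

Lemma transfer_ascending x : dart nb x -> ascending h' (transfer x) = ascending h x.
Proof.
by move=> /reached[i ->]; rewrite transfer_iter (same_wordE T T' dd dd').
Qed.

(* Depths along the contour are read off the word, and the reversal of an
   ascending edge is a first return in depth, so the word determines it. *)
Lemma transfer_rev x : dart nb x -> transfer (dart_rev x) = dart_rev (transfer x).
Proof.
case: (T) => s R [p pd]; case: (T') => s' R' [p' pd'].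
have up y : dart nb y -> ascending h y -> transfer (dart_rev y) = dart_rev (transfer y).
  move=> yd yu; have yu' := yu; rewrite -transfer_ascending // in yu'.
  have yd' := transfer_dart y.
  have [k [E H]] := reach_rev R pd yd yu.
  have [k' [E' H']] := reach_rev R' pd' yd' yu'.
  suff kk : k = k' by rewrite -E transfer_iter_step // {1}kk E'.
  have hD j : h' (iter j phi' (transfer y)).1 = h (iter j phi y).1.
    by rewrite -transfer_iter_step // transfer_depth //; apply: dart_iter.
  have hy : h y.2 = (h y.1).+1.
    by move: yu; rewrite /ascending; case: (depth_dart pd yd) => ->; lia.
  have hy' : h' (transfer y).2 = (h y.1).+1.
    move: yu'; rewrite /ascending; rewrite -(transfer_depth yd).
    by case: (depth_dart pd' yd') => ->; lia.
  (* One step after the reversed dart the source is back at the depth of [y.1], below the bound in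
     force up to the later of the two return times. Hence neither return precedes the other. *)
  have K : h (iter k.+2 phi y).1 = h y.1 by rewrite iterS E.
  have K' : h (iter k'.+2 phi y).1 = h y.1 by rewrite -hD iterS E' /= transfer_depth.
  case: (ltngtP k k') => // lt.
    by have := H' k.+2; rewrite hD K hy'; lia.
  by have := H k'.+2; rewrite K' hy; lia.
move=> xd; have [xu|] := boolP (ascending h x); first exact: up.
have xr : dart nb (dart_rev x) by apply: dart_rev_dart.
rewrite -(ascending_rev pd) // => xu.
by have := up _ xr xu; case: x {xd xr xu} => a b /= ->; case: transfer.
Qed.

(** A turn around a vertex is a reversal followed by a step, and [transfer] commutes with both. *)
Lemma transfer_same_source x y : dart nb x -> dart nb y -> x.1 = y.1 ->
  (transfer x).1 = (transfer y).1.
Proof.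
case: (T) => s R [p pd]; case: (T') => s' R' [p' pd'].
case: x => v w; case: y => v' w'; rewrite /dart /= => vw vw' E; subst v'.
have : w' \in porbit (rt v) w by case: (R v) => _ ->.
case/porbitP=> i ->{w' vw'}; rewrite permX; elim: i => [|i IH] //=.
have d1 : dart nb (v, iter i (rt v) w) by elim: i {IH} => //= i; apply: rot_nb.
rewrite IH -[(v, rt _ _)]/(phi (dart_rev (v, iter i (rt v) w))).
by rewrite transfer_step ?transfer_rev //; apply: dart_rev_dart.
Qed.

Let V0 v : exists w, w \in nb v.
Proof. by case: (T) => s R [p pd]; apply: (dart_at s pd). Qed.

Let some_nb v := xchoose (V0 v).
Let some_nbP v : dart nb (v, some_nb v). Proof. exact: (xchooseP (V0 v)). Qed.

(** The choice of a dart out of v is immaterial by [transfer_same_source]; one exists because there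
    are at least two vertices. *)
Definition vertex_map v := (transfer (v, some_nb v)).1.

Lemma transferE x : dart nb x -> transfer x = (vertex_map x.1, vertex_map x.2).
Proof.
move=> xd; have xr : dart nb (dart_rev x) by apply: dart_rev_dart; case: T.
have e1 y : dart nb y -> (transfer y).1 = vertex_map y.1.
  by move=> yd; apply: transfer_same_source.
have := e1 _ xr; rewrite transfer_rev //= => <-; rewrite -e1 //.
by case: (transfer x).
Qed.

Lemma vertex_map_onto v' : exists v, vertex_map v = v'.
Proof.
case: (T') => s R [p pd].
have [w wd] := dart_at s pd v' V1.
have [i E] := dart_reached T' dd' wd.
have yd : dart nb (iter i phi d) by apply: dart_iter; case: T.
by exists (iter i phi d).1; have := transferE yd; rewrite transfer_iter -E => -[].
Qed.

Lemma vertex_map_inj : injective vertex_map.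
Proof.
have : codom vertex_map =i predT.
  by move=> v'; have [v <-] := vertex_map_onto v'; rewrite codom_f.
move/eq_card => E; have: {in predT &, injective vertex_map}.
  by apply/image_injP/eqP.
by move=> I x y; apply: I.
Qed.

Lemma same_word_iso : exists f : {perm V},
  [/\ f r = r', forall v, nb' (f v) = [set f w | w in nb v] &
      forall v w, w \in nb v -> rt' (f v) (f w) = f (rt v w)].
Proof.
case: (T) => s R [p pd]; case: (T') => s' R' [p' pd'].
exists (perm vertex_map_inj); split=> [|v|v w vw]; rewrite ?permE.
- apply/eqP; rewrite -(depth_root pd') /vertex_map transfer_depth //=.
  by rewrite (depth_root pd).
- apply/setP => u; apply/idP/imsetP => [vu|[w vw ->]]; last first.
    have := transfer_dart (v, w); rewrite transferE //= => td.
    by rewrite permE.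
  have vu' : dart nb' (vertex_map v, u) by [].
  have [i E] := dart_reached T' dd' vu'.
  have yd : dart nb (iter i phi d) by apply: dart_iter; case: T.
  move: (transferE yd); rewrite transfer_iter -E => -[/vertex_map_inj vE uE].
  by exists (iter i phi d).2; rewrite ?permE // vE; apply: yd.
have xd : dart nb (v, w) by [].
have xr := dart_rev_dart s xd.
have := transfer_step xr; rewrite transfer_rev // !transferE //=.
  by case=> ->.
exact: rot_nb.
Qed.

End Iso.
End SameWord.

(** * The plane tree of a Dyck word *)

Section CyclicOrder.
Variable m : nat.
Implicit Type A : {set 'I_m}.

Lemma enum_sorted A : sorted (relpre val ltn) (enum A).
Proof.
have -> : enum A = filter (mem A) (enum 'I_m) by rewrite {1}/enum_mem enumT.
apply: sorted_filter; first by move=> a b c; apply: ltn_trans.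
by rewrite -sorted_map val_enum_ord iota_ltn_sorted.
Qed.

Lemma next_split (T : eqType) (s1 s2 : seq T) v : uniq (s1 ++ v :: s2) ->
  next (s1 ++ v :: s2) v = head v (s2 ++ s1).
Proof.
move=> us; rewrite -(next_rot (size s1) us) rot_size_cat /=.
by case: (s2 ++ s1) => [|y q] /=; rewrite eqxx.
Qed.

Lemma next_enum_succ A v y : v \in A -> y \in A -> v < y ->
  (forall z, z \in A -> v < z -> y <= z) -> next (enum A) v = y.
Proof.
move=> vA yA vy H.
have := enum_sorted A; have := enum_uniq A; have : y \in enum A by rewrite mem_enum.
have: {subset enum A <= A} by move=> z; rewrite mem_enum.
have : v \in enum A by rewrite mem_enum.
case/splitPr => s1 s2 sub yin us so; rewrite next_split //.
have tr : transitive (relpre (@nat_of_ord m) ltn) by move=> a b c; apply: ltn_trans.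
move: so; rewrite sorted_pairwise // pairwise_cat /=.
move=> /and3P[/allrelP s1v _ /andP[/allP vs2 so2]].
move: yin; rewrite mem_cat inE => /or3P[ys1|/eqP E|ys2].
- by have := s1v y v ys1 (mem_head _ _); rewrite /=; lia.
- by rewrite E ltnn in vy.
case: s2 => // z s2 in sub us s1v so2 vs2 ys2 *; rewrite /=; apply: val_inj.
have vz := vs2 z (mem_head _ _).
have zA : z \in A by apply: sub; rewrite mem_cat !inE eqxx !orbT.
have := H z zA vz; move: ys2; rewrite inE => /predU1P[->//|ys2].
by case/andP: so2 => /allP/(_ y ys2) /=; lia.
Qed.

Lemma next_enum_wrap A v y : v \in A -> y \in A ->
  (forall z, z \in A -> y <= z <= v) -> next (enum A) v = y.
Proof.
move=> vA yA H.
have := enum_sorted A; have := enum_uniq A; have : y \in enum A by rewrite mem_enum.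
have: {subset enum A <= A} by move=> z; rewrite mem_enum.
have : v \in enum A by rewrite mem_enum.
case/splitPr => s1 s2 sub yin us so; rewrite next_split //.
have tr : transitive (relpre (@nat_of_ord m) ltn) by move=> a b c; apply: ltn_trans.
move: so; rewrite sorted_pairwise // pairwise_cat /=.
move=> /and3P[/allrelP s1v so1 /andP[/allP vs2 so2]].
case: s2 => [|z s2] in sub us s1v so2 vs2 yin *; last first.
  have vz := vs2 z (mem_head _ _).
  have zA : z \in A by apply: sub; rewrite mem_cat !inE eqxx !orbT.
  by have := H z zA; move: vz; rewrite /=; lia.
case: s1 => [|z s1] in sub us s1v so1 yin *; first by move: yin; rewrite /= inE => /eqP.
have zA : z \in A by apply: sub; rewrite mem_cat !inE eqxx.
apply: val_inj; have := H z zA => /=; move: yin; rewrite inE => /predU1P[->//|].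
rewrite mem_cat inE orbC => /predU1P[yv|ys1].
  by have := s1v z v (mem_head _ _) (mem_head _ _); rewrite /= -yv; lia.
by case/andP: so1 => /allP/(_ y ys1) /=; lia.
Qed.

Definition next_perm A : {perm 'I_m} := perm (can_inj (prev_next (enum_uniq A))).

Lemma next_perm_on A : perm_on A (next_perm A).
Proof.
apply/subsetP => x; rewrite inE permE; apply: contraNT => xA.
by rewrite next_nth mem_enum (negbTE xA).
Qed.

Lemma porbit_next_perm A x : x \in A -> porbit (next_perm A) x = A.
Proof.
move=> xA; apply/setP => y; have xA' : x \in enum A by rewrite mem_enum.
rewrite -[RHS]mem_enum -(fconnect_cycle (cycle_next (enum_uniq A)) xA').
apply/porbitP/idP => [[i ->]|/iter_findex <-].
  rewrite permX (eq_iter (f' := next (enum A))) ?fconnect_iter // => z.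
  by rewrite permE.
exists (findex (next (enum A)) x y); rewrite permX; apply: eq_iter => z.
by rewrite permE.
Qed.

End CyclicOrder.

(** * Trees on numbered vertices in which parents come first *)

Section IncreasingTree.
Variables (n : nat) (par : nat -> nat).
Hypothesis par_lt : forall m, 0 < m <= n -> par m < m.
Implicit Types v w : 'I_n.+1.

Definition inc_nb v : {set 'I_n.+1} :=
  [set w : 'I_n.+1 | (0 < w) && (par w == v) || (0 < v) && (par v == w)].
(* Parents precede children, so the increasing list of the neighbours of v is
   its parent followed by its children. *)
Definition inc_rot v := next_perm (inc_nb v).

(** [k] is fuel; m units suffice for vertex m since parents have smaller numbers. *)
Fixpoint par_depth k m :=
  if k is k'.+1 then if m == 0 then 0 else (par_depth k' (par m)).+1 else 0.

Definition inc_depth m := par_depth m m.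

Lemma par_depth_fuel k m : m <= k -> m <= n -> par_depth k m = inc_depth m.
Proof.
rewrite /inc_depth; have [N] := ubnP m; elim: N k m => // N IH [|k] [|m] //= mN mk mn.
have lt : par m.+1 < m.+1 by apply: par_lt; rewrite /= mn.
by rewrite IH 1?[in RHS]IH //; lia.
Qed.

Lemma inc_depthS m : 0 < m <= n -> inc_depth m = (inc_depth (par m)).+1.
Proof.
case: m => // m mn; have lt := par_lt mn.
by rewrite {1}/inc_depth /= par_depth_fuel //; lia.
Qed.

Lemma inc_nb_sym : symmetric (fun v w => w \in inc_nb v).
Proof. by move=> v w; rewrite !inE orbC. Qed.

Lemma inc_nb_irr : irreflexive (fun v w => w \in inc_nb v).
Proof.
move=> v; rewrite !inE orbb; apply/andP => -[v0 /eqP E].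
by have := @par_lt v; rewrite v0 E -ltnS ltn_ord ltnn => /(_ isT).
Qed.

Let par_ltn v : 0 < v -> par v < v.
Proof. by move=> v0; apply: par_lt; rewrite v0 -ltnS /=. Qed.

Let par_ord v : 0 < v -> par v < n.+1.
Proof. by move=> /par_ltn /ltn_trans; apply. Qed.

Lemma inc_connect0 v : connect (fun v w => w \in inc_nb v) v ord0.
Proof.
have [N] := ubnP (nat_of_ord v); elim: N v => // N IH v vN.
have [v0|v0] := posnP (nat_of_ord v).
  by rewrite (_ : v = ord0) ?connect0 //; apply: val_inj.
have lt := par_ord v0; apply: (@connect_trans _ _ (Ordinal lt)).
  by apply: connect1; rewrite inE /= v0 eqxx orbT.
by apply: IH => /=; have := par_ltn v0; lia.
Qed.

Lemma inc_connect v w : connect (fun v w => w \in inc_nb v) v w.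
Proof.
apply: connect_trans (inc_connect0 v) _.
by rewrite (sym_connect_sym inc_nb_sym) inc_connect0.
Qed.

(** In a cycle of length at least 3 the largest vertex would have two distinct smaller neighbours,
    but its parent is its only smaller neighbour. *)
Lemma inc_acyclic c : ucycle (fun v w => w \in inc_nb v) c -> size c <= 2.
Proof.
case: c => // v0 c0; set c := v0 :: c0.
have c0P : v0 \in c by apply: mem_head.
case: (@arg_maxnP _ v0 (mem c) val c0P) => m mc mmax.
have [i s E] := rot_to mc; rewrite -(rot_ucycle i) E => /andP[cy us].
rewrite -(size_rot i) E.
have sub z : z \in s -> z <= m.
  by move=> zs; apply: mmax; rewrite /= -(mem_rot i) E inE zs orbT.
case: s E cy us sub => [|a [|b q]] // E cy us sub.
move: cy; rewrite /= rcons_path /= => /and3P[ma ab /andP[bq lm]].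
have key z : z \in [:: a, b & q] -> z \in inc_nb m -> par m = z.
  move=> /sub zm; rewrite inE => /orP[/andP[z0 /eqP zE]|/andP[_ /eqP]//].
  by have := par_ltn z0; lia.
have e1 := key a (mem_head _ _) ma.
have l2 : last b q \in [:: a, b & q] by rewrite inE mem_last orbT.
have e2 := key _ l2; rewrite inc_nb_sym in e2; have {}e2 := e2 lm.
have : a = last b q by apply: val_inj; rewrite /= -e1 -e2.
move=> aE; move: us; rewrite /= => /and3P[_ + _].
by rewrite {1}aE mem_last.
Qed.

Lemma inc_parent_depth : exists p,
  parent_depth (fun v w => w \in inc_nb v) ord0 p (fun v => inc_depth v).
Proof.
(* At the root this value is arbitrary, which [parent_depth] allows. *)
exists (fun v => inord (par v)).
have v0 v : v != ord0 -> 0 < v by rewrite lt0n; apply: contraNN => /eqP E; apply/eqP/val_inj.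
have v1 v : 0 < v -> v != ord0 by move=> v2; apply/eqP => E; rewrite E in v2.
split=> // [v /v0 v2|v w].
  have lt := par_ord v2; rewrite inE inordK // v2 eqxx orbT; split=> //.
  by apply: inc_depthS; rewrite v2 -ltnS /=.
rewrite inE => /orP[]/andP[x0 /eqP xE]; [right|left].
  by split; [exact: v1|apply: val_inj; rewrite /= inordK ?xE].
by split; [exact: v1|apply: val_inj; rewrite /= inordK ?xE].
Qed.

Lemma inc_plane_tree : plane_tree_with ord0 inc_nb inc_rot (fun v => inc_depth v).
Proof.
split; [exact: inc_nb_sym| |exact: inc_parent_depth].
by move=> v; split; [apply: next_perm_on|move=> u; apply: porbit_next_perm].
Qed.

End IncreasingTree.

(** * A Dyck word is the contour word of the tree built by a stack *)

Section DyckTree.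
Variables (n : nat) (W : nat -> bool).

Fixpoint ups i := if i is i'.+1 then ups i' + W i' else 0.

(* Vertices are numbered in the order in which they are reached; the stack holds
   the path from the current vertex (its head) down to the root 0. *)
Fixpoint stack i := if i is i'.+1 then
  if W i' then (ups i').+1 :: stack i' else behead (stack i') else [:: 0].

Hypothesis dyck : forall i, i <= n.*2 -> i <= (ups i).*2.
Hypothesis upsn : ups n.*2 = n.

Definition top i := head 0 (stack i).

(* The parent of vertex m, i.e. the top of the stack when m is pushed. *)
Definition pushed_on m :=
  top (find (fun i => W i && (ups i == m.-1)) (iota 0 n.*2)).

Lemma ups_mono i j : i <= j -> ups i <= ups j.
Proof.
move=> /subnK <-; elim: (j - i) => [|k IH] /=; first by rewrite add0n.
by apply: leq_trans IH _; rewrite leq_addr.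
Qed.

Lemma ups_lt i j : W i -> i < j -> ups i < ups j.
Proof. by move=> Wi /ups_mono; apply: leq_trans; rewrite /= Wi addn1. Qed.

Lemma ups_le i : i <= n.*2 -> ups i <= n.
Proof. by rewrite -{2}upsn; apply: ups_mono. Qed.

Lemma pushed_onE i : i < n.*2 -> W i -> pushed_on (ups i).+1 = top i.
Proof.
move=> iN Wi; rewrite /pushed_on /=; set P := fun _ => _; congr top.
have hP : has P (iota 0 n.*2).
  by apply/hasP; exists i; rewrite ?mem_iota // /P Wi eqxx.
have := nth_find 0 hP; have := hP; rewrite has_find size_iota; set j := find _ _ => jN.
rewrite nth_iota // add0n => /andP[Wj /eqP E].
by case: (ltngtP j i) => // [/(ups_lt Wj)|/(ups_lt Wi)]; rewrite E ltnn.
Qed.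

Lemma up_step_of m i : 0 < m <= ups i -> exists j, [/\ j < i, W j & m = (ups j).+1].
Proof.
elim: i => /= [|i IH] H; first by lia.
have [mi|mi] := leqP m (ups i).
  by have [|j [ji Wj ->]] := IH; [lia|exists j; split=> //; apply: leqW].
by exists i; split => //; move: H mi; case: (W i); lia.
Qed.

Let chain : rel nat := fun a b => (b < a) && (pushed_on a == b).

(** The size is 1 plus ups minus downs, so the Dyck condition keeps the stack from emptying. The
    default 1 of [last] makes the final clause also exclude the empty stack. *)
Lemma stack_inv i : i <= n.*2 ->
  [/\ size (stack i) + i = (ups i).*2.+1, sorted chain (stack i),
      all (fun z => z <= ups i) (stack i) & last 1 (stack i) = 0].
Proof.
elim: i => // i IH iN; have [sz so al la] := IH (ltnW iN); have dy := dyck iN.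
move: dy => /=; case E: (W i); rewrite ?addn1 ?addn0 => dy /=.
  split.
  - by rewrite addSn addnS sz doubleS.
  - move: (pushed_onE iN E) so al la; rewrite /top.
    case: (stack i) => //= a s pE -> /andP[az _] _.
    by rewrite /chain ltnS az pE eqxx.
  - by rewrite leqnn /=; apply: sub_all al => z /leqW.
  - by case: (stack i) la.
move: sz so al la; case: (stack i) => [|a [|b s]] /= sz so al la; [lia|lia|].
by split=> //; [move: sz; lia|case/andP: so|case/andP: al].
Qed.

Lemma stack_cons i : i <= n.*2 -> stack i = top i :: behead (stack i).
Proof. by case/stack_inv; rewrite /top; case: (stack i). Qed.

Lemma top_mem i : i <= n.*2 -> top i \in stack i.
Proof. by move=> iN; rewrite stack_cons // mem_head. Qed.

Lemma stack_le i z : i <= n.*2 -> z \in stack i -> z <= ups i.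
Proof. by case/stack_inv => _ _ /allP H _ /H. Qed.

Lemma top_le i : i <= n.*2 -> top i <= ups i.
Proof. by move=> iN; apply: stack_le => //; apply: top_mem. Qed.

Let stack_gtn i : i <= n.*2 -> sorted gtn (stack i).
Proof. by case/stack_inv => _ so _ _; apply: sub_sorted so => a b /andP[]. Qed.

Lemma stack_le_top i z : i <= n.*2 -> z \in stack i -> z <= top i.
Proof.
move=> iN; have := stack_gtn iN; rewrite stack_cons //= => /order_path_min H.
have /allP {}H := H (rev_trans ltn_trans).
by rewrite inE => /predU1P[->//|/H]; apply: ltnW.
Qed.

(** Whatever is pushed from time i on has a number above [ups i], so a smaller entry must have been
    there all along. *)
Lemma stack_old i j z : i <= j -> z \in stack j -> z <= ups i -> z \in stack i.
Proof.
move=> /subnK <-; elim: (j - i) => [|k IH] /=; first by rewrite add0n.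
have ik : ups i <= ups (k + i) by apply: ups_mono; apply: leq_addl.
case: (W _) => [|zs]; last by apply: IH; apply: mem_behead.
by rewrite inE => /predU1P[->|]; [lia|exact: IH].
Qed.

Lemma popped i j : ~~ W i -> i < n.*2 -> i < j -> top i \notin stack j.
Proof.
move=> Wi iN ij; apply/negP => /(stack_old ij); rewrite /= (negbTE Wi) addn0.
move/(_ (top_le (ltnW iN))) => H; have := stack_gtn (ltnW iN).
rewrite stack_cons ?(ltnW iN) // sorted_pairwise; last exact: (rev_trans ltn_trans).
by case/andP => /allP/(_ _ H); rewrite /= ltnn.
Qed.

Lemma top_up i : W i -> top i.+1 = (ups i).+1.
Proof. by rewrite /top /= => ->. Qed.

Lemma top_down i : i < n.*2 -> ~~ W i -> 0 < top i /\ pushed_on (top i) = top i.+1.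
Proof.
move=> iN Wi; have [_ so _ _] := stack_inv (ltnW iN).
have [_ _ _ la] := stack_inv iN.
move: so la; rewrite (stack_cons (ltnW iN)) /top /= (negbTE Wi).
case: (behead _) => // b s /= /andP[/andP[ba /eqP pab] _] _; split=> //.
exact: leq_ltn_trans ba.
Qed.

Lemma pushed_on_lt m : 0 < m <= n -> pushed_on m < m.
Proof.
rewrite -{1}upsn => /up_step_of[j [jN Wj ->]].
by rewrite pushed_onE // ltnS top_le // ltnW.
Qed.

Lemma child_step w z : 0 < z <= n -> pushed_on z = w ->
  exists j, [/\ j < n.*2, W j, z = (ups j).+1 & top j = w].
Proof.
move=> zn zw; have [|j [jN Wj zE]] := @up_step_of z n.*2; first by rewrite upsn.
by exists j; split=> //; rewrite -zw zE pushed_onE.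
Qed.

Local Notation par := pushed_on.
Local Notation nb := (@inc_nb n par).
Local Notation rt := (@inc_rot n par).

Let vx i : 'I_n.+1 := inord (top i).

Let vxE i : i <= n.*2 -> vx i = top i :> nat.
Proof. by move=> iN; rewrite inordK // ltnS (leq_trans (top_le iN)) // ups_le. Qed.

Let in_nb (w z : 'I_n.+1) : (z \in nb w) =
  (0 < z) && (par z == w) || (0 < w) && (par w == z).
Proof. by rewrite inE. Qed.

Lemma walk_dart i : i < n.*2 -> dart nb (vx i, vx i.+1).
Proof.
move=> iN; rewrite /dart in_nb /= !vxE // ?(ltnW iN) //.
have [Wi|Wi] := boolP (W i); first by rewrite top_up // pushed_onE // eqxx.
by have [-> ->] := top_down iN Wi; rewrite eqxx orbT.
Qed.

(** The neighbours of a vertex, in increasing order, are its parent and then its children in order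
    of discovery. An up step goes to the next child; a down step occurs when no child is left, and
    the cyclic order wraps around to the parent. *)
Lemma walk_rot i : i.+1 < n.*2 -> rt (vx i.+1) (vx i) = vx i.+2.
Proof.
move=> iN2; have iN : i < n.*2 by apply: ltnW.
have d1 := walk_dart iN; have d2 := walk_dart iN2.
rewrite permE; have x1 : vx i \in nb (vx i.+1) by rewrite inc_nb_sym.
have child (z : 'I_n.+1) : z \in nb (vx i.+1) ->
    [\/ 0 < vx i.+1 /\ par (vx i.+1) = z | exists j,
        [/\ j < n.*2, W j, z = (ups j).+1 :> nat & top j = top i.+1]].
  rewrite in_nb => /orP[/andP[z0 /eqP zE]|/andP[v0 /eqP]]; [right|by left].
  have zn : 0 < z <= n by rewrite z0 -ltnS ltn_ord.
  have [j [jN Wj E E']] := child_step zn zE; exists j; split => //.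
  by rewrite E' vxE.
have low (z : 'I_n.+1) : 0 < vx i.+1 -> par (vx i.+1) = z -> z < vx i.+1.
  by move=> v0 <-; apply: pushed_on_lt; rewrite v0 -ltnS ltn_ord.
have high j : j < n.*2 -> top j = top i.+1 -> vx i.+1 < (ups j).+1.
  by move=> jN E; rewrite vxE // -E ltnS top_le // ltnW.
(* In this first case the current vertex has just been created and the walk arrives from its
   parent. *)
have [Wi|Wi] := boolP (W i).
  have tE : top i.+1 = (ups i).+1 by apply: top_up.
  have pE : par (vx i.+1) = vx i by rewrite !vxE // ?(ltnW iN) // tE pushed_onE.
  have x1_lt : vx i < vx i.+1 by apply: low; rewrite ?pE // vxE // tE.
  have [Wi2|Wi2] := boolP (W i.+1).
    have tE2 : top i.+2 = (ups i).+2 by rewrite top_up //= Wi addn1.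
    apply: next_enum_succ => //.
      by rewrite !vxE ?(ltnW iN) // tE2 in x1_lt *; rewrite tE in x1_lt; lia.
    move=> z /child[[_ <-]|[j [jN Wj -> E]]]; first by rewrite pE; lia.
    by move=> _; rewrite vxE // tE2; have := high j jN E; rewrite vxE // tE.
  (* The current vertex is a leaf: a child would be pushed on it after it was popped. Its only
     neighbour is the parent, its own cyclic successor. *)
  have [_ t2] := top_down iN2 Wi2.
  have x2E : vx i.+2 = vx i.
    by apply: val_inj; rewrite /= [LHS]vxE // -t2 -pE vxE.
  rewrite x2E; apply: next_enum_wrap => // z /child[[_ <-]|[j [jN Wj zE E]]].
    by rewrite pE leqnn.
  have tj := top_le (ltnW jN); rewrite E tE in tj.
  have ij : i < j by rewrite ltnNge; apply/negP => /ups_mono; lia.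
  have ij2 : i.+1 < j.
    by rewrite ltn_neqAle ij andbT; apply: contraNneq Wi2 => ->.
  have := popped Wi2 iN2 ij2; rewrite -E top_mem // ltnW //.
have [t0 tE] := top_down iN Wi.
have uE : ups i.+1 = ups i by rewrite /= (negbTE Wi) addn0.
have pi_lt : top i.+1 < top i.
  rewrite -tE; apply: pushed_on_lt.
  by rewrite t0 (leq_trans (top_le (ltnW iN))) // ups_le // ltnW.
(* A child numbered above the one just left was created later. Had it been created at a time j
   before i, [top i] would already lie in the stack at time j, hence not exceed [top j], its own
   parent. *)
have between j : j < n.*2 -> top j = top i.+1 -> top i <= ups j -> i <= j.
  move=> jN E H; rewrite leqNgt; apply/negP => ji.
  have := stack_old (ltnW ji) (top_mem (ltnW iN)) H.
  by move/(stack_le_top (ltnW jN)); rewrite E; lia.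
have [Wi2|Wi2] := boolP (W i.+1).
  have tE2 : top i.+2 = (ups i).+1 by rewrite top_up // uE.
  apply: next_enum_succ => //.
    by rewrite !vxE ?(ltnW iN) // tE2 ltnS top_le // ltnW.
  move=> z /child[[v0 zE]|[j [jN Wj zE E]]].
    by have := low z v0 zE; rewrite !vxE ?(ltnW iN) //; lia.
  rewrite zE !vxE ?(ltnW iN) // tE2 => /between-/(_ jN E) ij.
  by rewrite ltnS; apply: ups_mono.
(* The child just left is the last one, since a later child would need the popped vertex on the
   stack. *)
have [s0 t2] := top_down iN2 Wi2.
apply: next_enum_wrap => // z zn; have pz : par (vx i.+1) = vx i.+2 by rewrite !vxE.
have x2 : vx i.+2 < vx i.+1 by apply: low => //; rewrite vxE.
apply/andP; split.
  case/child: zn => [[_ <-]|[j [jN Wj zE E]]]; first by rewrite pz.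
  by have := high j jN E; rewrite -zE; lia.
case/child: zn => [[_ <-]|[j [jN Wj zE E]]].
  by rewrite pz; move: x2; rewrite !vxE ?(ltnW iN) //; lia.
rewrite leqNgt; apply/negP; rewrite zE !vxE ?(ltnW iN) // ltnS => /(between j jN E) ij.
have ij1 : i < j by rewrite ltn_neqAle ij andbT; apply: contraNneq Wi => ->.
have ij2 : i.+1 < j.
  by rewrite ltn_neqAle ij1 andbT; apply: contraNneq Wi2 => ->.
have := popped Wi2 iN2 ij2; rewrite -E top_mem // ltnW //.
Qed.

Lemma walk_iter i : i < n.*2 ->
  iter i (contour_step rt) (vx 0, vx 1) = (vx i, vx i.+1).
Proof.
elim: i => // i IH iN; rewrite iterS IH 1?ltnW // /contour_step /=.
by rewrite walk_rot.
Qed.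

Lemma walk_ascending i : i < n.*2 ->
  ascending (fun v : 'I_n.+1 => inc_depth par v)
    (iter i (contour_step rt) (vx 0, vx 1)) = W i.
Proof.
move=> iN; rewrite walk_iter // /ascending /= !vxE // ?(ltnW iN) //.
have [Wi|Wi] := boolP (W i).
  rewrite top_up // [inc_depth _ (ups i).+1](@inc_depthS n).
  - by rewrite pushed_onE // leqnn.
  - exact: pushed_on_lt.
  by have := ups_le iN; rewrite /= Wi addn1.
have [t0 tE] := top_down iN Wi; rewrite [inc_depth _ (top i)](@inc_depthS n).
- by rewrite tE ltnNge leqnSn.
- exact: pushed_on_lt.
by rewrite t0 (leq_trans (top_le (ltnW iN))) // ups_le // ltnW.
Qed.

End DyckTree.

(** * Bridges with area divisible by their length *)

(** The values 0, 1, 2 arise from 1, 2, 1 of the four pairs: the law of a lazy step, shifted by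
    1. *)
Definition bits (b : bool * bool) : nat := b.1 + b.2.

(* With steps [bits b - 1] these are the bridges of length k whose area is
   divisible by k, see [residue_tuplesE]. *)
Definition residue_words k : {set {ffun 'I_k -> bool * bool}} :=
  [set w : {ffun 'I_k -> bool * bool} | (\sum_i bits (w i) == k) &&
    (\sum_(i < k) i * bits (w i) == \sum_(i < k) i %[mod k])].

Local Open Scope ring_scope.

(** Orthogonality of characters, a geometric sum whose ratio [y] is a k-th root of unity. It serves
    as the indicator of a congruence. *)
Lemma sum_prim_root (F : fieldType) k (z : F) (m c : nat) : k.-primitive_root z ->
  \sum_(j < k) (z ^+ j) ^+ m / (z ^+ j) ^+ c = if m == c %[mod k] then k%:R else 0.
Proof.
move=> zP; have z0 : z != 0.
  apply/eqP => E; have := prim_expr_order zP.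
  by rewrite E expr0n gtn_eqF ?(prim_order_gt0 zP) // => /esym/eqP; rewrite oner_eq0.
have zc0 i : z ^+ i != 0 by rewrite expf_neq0.
pose y := z ^+ m / z ^+ c.
transitivity (\sum_(j < k) y ^+ j).
  by apply: eq_bigr => j _; rewrite expr_div_n -!exprM ![(_ * j)%N]mulnC.
have yk : y ^+ k = 1.
  by rewrite expr_div_n -!exprM ![(_ * k)%N]mulnC !exprM (prim_expr_order zP) !expr1n divr1.
have yE : (y == 1) = (m == c %[mod k]).
  by rewrite -(eq_prim_root_expr zP) /y -(inj_eq (mulIf (zc0 c))) divfK // mul1r.
rewrite -yE; have [->|y1] := eqVneq y 1.
  by rewrite (eq_bigr (fun=> 1)) ?sumr_const ?card_ord // => j _; rewrite expr1n.
have := subrX1 y k; rewrite yk subrr => /esym/eqP.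
by rewrite mulf_eq0 subr_eq0 (negbTE y1) => /eqP.
Qed.

Section RootOfUnity.
Variables (F : fieldType) (m d : nat) (z : F).
Hypothesis zP : m.-primitive_root z.
Local Notation s := (- (-1) ^+ m : F).

(** Substitute -X in the factorization of X ^ m - 1, once for each of the d periods. The sign [s] is
    the product of all m-th roots of unity. *)
Lemma prod_X_add_root :
  \prod_(i < d * m) ('X + (z ^+ i)%:P) = ('X^m + s%:P) ^+ d.
Proof.
have -> : \prod_(i < d * m) ('X + (z ^+ i)%:P) = \prod_(i < d * m) ('X + (z ^+ (i %% m)%N)%:P).
  by apply: eq_bigr => i _; rewrite (prim_expr_mod zP).
rewrite (big_ord_modn _ d m (fun i => 'X + (z ^+ i)%:P)) prodr_const card_ord.
congr (_ ^+ _).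
have /(congr1 (fun p => p \Po (- 'X))) := factor_Xn_sub_1 zP.
rewrite big_mkord rmorph_prod /= rmorphB rmorphXn /= comp_polyX rmorph1.
under eq_bigr => i _ do rewrite rmorphB /= comp_polyX comp_polyC -opprD.
rewrite prodrN card_ord (exprNn 'X) => /(congr1 (fun p => (-1) ^+ m * p)).
rewrite signrMK mulrBr signrMK mulr1.
move=> E; apply: etrans E _; by rewrite polyCN polyC_exp polyCN polyC1.
Qed.

Lemma prod_roots : \prod_(i < d * m) z ^+ i = s ^+ d.
Proof.
have m0 := prim_order_gt0 zP.
have := congr1 (fun p => p.[0]) prod_X_add_root.
rewrite horner_prod horner_exp !hornerE expr0n gtn_eqF // add0r => <-.
by apply: eq_bigr => i _; rewrite !hornerE.
Qed.

Lemma coef_middle : (('X^m + s%:P) ^+ d.*2)`_(d * m) = s ^+ d * 'C(d.*2, d)%:R.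
Proof.
have m0 := prim_order_gt0 zP.
rewrite exprDn coef_sum.
have dlt : (d < d.*2.+1)%N by rewrite ltnS -addnn leq_addr.
rewrite (bigD1 (Ordinal dlt)) //= big1 ?addr0 => [|i ne].
  rewrite -exprM -polyC_exp coefMn mulrC coefCM coefXn.
  rewrite (_ : d.*2 - d = d)%N; last by rewrite -addnn addnK.
  by rewrite mulnC eqxx mulr1 mulr_natr.
rewrite -exprM -polyC_exp coefMn mulrC coefCM coefXn.
case: eqP => [E|]; last by rewrite mulr0 mul0rn.
case/eqP: ne; apply: val_inj => /=; move: E; rewrite mulnC => /eqP.
by rewrite eqn_pmul2l // => /eqP; have := ltn_ord i; lia.
Qed.

(** Position i contributes (X + z ^ i) ^ 2, whose expansion over the four pairs b has terms z ^ (i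
    bits b) X ^ (2 - bits b). The middle coefficient of the product selects the words of total d
    m. *)
Lemma sum_balanced_root :
  \sum_(w : {ffun 'I_(d * m) -> bool * bool} | (\sum_i bits (w i) == d * m)%N)
     z ^+ (\sum_(i < d * m) i * bits (w i))%N = s ^+ d * 'C(d.*2, d)%:R.
Proof.
rewrite -coef_middle -mul2n [(2 * d)%N]mulnC exprM -prod_X_add_root -prodrXl.
pose f (i : 'I_(d * m)) (b : bool * bool) : {poly F} := (z ^+ (i * bits b))%:P * 'X^(2 - bits b).
have -> : \prod_(i < d * m) ('X + (z ^+ i)%:P) ^+ 2 = \prod_(i < d * m) \sum_b f i b.
  apply: eq_bigr => i _; rewrite -(pair_bigA _ (fun a b => f i (a, b))) /= !big_bool /f /bits /=.
  rewrite muln0 muln1 mulnS muln1 !addn0 add0n expr0 mulr1 subn0 exprD polyCM polyC1.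
  rewrite ?expr0 ?expr1. ring.
rewrite bigA_distr_bigA coef_sum /= big_mkcond; apply: eq_bigr => w _.
rewrite /f [in RHS]big_split /= -rmorph_prod /= coefCM.
rewrite !prodrXr coefXn.
have bits2 b : (bits b <= 2)%N by case: b => [[] []].
have S2 : (\sum_i bits (w i) <= (d * m) * 2)%N.
  rewrite -[X in (_ <= X * 2)%N]card_ord -sum_nat_const.
  by apply: leq_sum => i _; apply: bits2.
rewrite sumnB ?sum_nat_const ?card_ord => [|i _]; last exact: bits2.
have -> : (d * m == d * m * 2 - \sum_i bits (w i))%N = (\sum_i bits (w i) == d * m)%N.
  by move: S2; set S := (\sum_i _)%N; lia.
by case: eqP => _; rewrite ?mulr1 ?mulr0.
Qed.

End RootOfUnity.

Lemma card_residue_words k : (0 < k)%N ->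
  (k * #|residue_words k| = \sum_(j < k) 'C((gcdn j k).*2, gcdn j k))%N.
Proof.
move=> k0; have [z zP] := C_prim_root_exists k0.
apply/eqP; rewrite -(eqr_nat algC) natrM natr_sum mulrC.
pose c := (\sum_(i < k) i)%N.
pose S (w : {ffun 'I_k -> bool * bool}) := (\sum_(i < k) i * bits (w i))%N.
transitivity ((\sum_(w : {ffun 'I_k -> bool * bool} | (\sum_i bits (w i) == k)%N)
    \sum_(j < k) (z ^+ j) ^+ S w / (z ^+ j) ^+ c) == \sum_(j < k) 'C((gcdn j k).*2, gcdn j k)%:R).
  congr (_ == _); under [RHS]eq_bigr => w _ do rewrite (sum_prim_root _ _ zP).
  rewrite -big_mkcondr /= sumr_const [LHS]mulrC -[RHS]mulr_natr; congr (_ * _%:R).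
  by apply: eq_card => w; rewrite !inE.
rewrite exchange_big /=; apply/eqP; apply: eq_bigr => j _.
set g := gcdn j k; have gk : (g %| k)%N by apply: dvdn_gcdr.
have g0 : (0 < g)%N by rewrite gcdn_gt0 k0 orbT.
have uP := exp_prim_root zP j; rewrite -/g in uP.
set u := z ^+ j in uP *; set m := (k %/ g)%N in uP.
have kE : k = (g * m)%N by rewrite mulnC divnK.
rewrite -mulr_suml.
(* The exponent c adds up all positions, so this is the product of the u ^ i: the very sign
   appearing in [sum_balanced_root], and the two cancel. *)
have -> : u ^+ c = (- (-1) ^+ m) ^+ g.
  by rewrite -(prod_roots g uP) prodrXr /c kE.
have := sum_balanced_root g uP; rewrite -kE => ->.
rewrite mulrAC divff ?mul1r //.
by rewrite expf_neq0 // oppr_eq0 expf_neq0 // oppr_eq0 oner_eq0.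
Qed.

(** * The cycle lemma *)

Section Walks.
Implicit Types (x y : nat -> int) (i j k l m : nat).

Fixpoint height x i : int := if i is i'.+1 then height x i' + x i' else 0.
Fixpoint sarea x i : int := if i is i'.+1 then sarea x i' + height x i else 0.

Lemma sareaS x i : sarea x i.+1 = sarea x i + height x i.+1. Proof. by []. Qed.

Definition hit x i := (height x i == 0) && (sarea x i == 0).
Definition nnloop x k :=
  hit x k && all (fun i => (height x i == 0) ==> (0 <= sarea x i)) (iota 0 k.+1).
Definition hits x k := (\sum_(i < k) hit x i.+1)%N.
Definition walk_from j x i := x (j + i)%N.

Lemma nnloopP x k : reflect
  (hit x k /\ forall i, (i <= k)%N -> height x i = 0 -> 0 <= sarea x i) (nnloop x k).
Proof.
apply: (iffP andP) => [[hk /allP H]|[hk H]]; split=> //.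
  by move=> i ik hi; apply: (implyP (H i _)); rewrite ?mem_iota //; apply/eqP.
by apply/allP => i; rewrite mem_iota ltnS => /H Hi; apply/implyP => /eqP.
Qed.

Lemma height_ext x y k : (forall i, (i < k)%N -> x i = y i) -> height x k = height y k.
Proof. by elim: k => //= k IH H; rewrite IH ?H // => i ik; apply: H; apply: ltnW. Qed.

Lemma sarea_ext x y k : (forall i, (i < k)%N -> x i = y i) -> sarea x k = sarea y k.
Proof.
elim: k => //= k IH H; rewrite IH => [|i ik]; last by apply: H; apply: ltnW.
by rewrite (@height_ext x y) ?H // => i ik; apply: H; apply: ltnW.
Qed.

Lemma hit_ext x y k : (forall i, (i < k)%N -> x i = y i) -> hit x k = hit y k.
Proof. by move=> H; rewrite /hit (height_ext H) (sarea_ext H). Qed.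

Lemma nnloop_ext x y k : (forall i, (i < k)%N -> x i = y i) -> nnloop x k = nnloop y k.
Proof.
move=> H; rewrite /nnloop (hit_ext H); congr (_ && _); apply: eq_in_all => i.
rewrite mem_iota ltnS /= => ik.
have Hi j : (j < i)%N -> x j = y j by move=> ji; apply: H; apply: leq_trans ik.
by rewrite (height_ext Hi) (sarea_ext Hi).
Qed.

Lemma hits_ext x y k : (forall i, (i < k)%N -> x i = y i) -> hits x k = hits y k.
Proof.
move=> H; apply: eq_bigr => i _; congr nat_of_bool; apply: hit_ext => j ji.
by apply: H; apply: leq_trans ji _.
Qed.

Lemma height_from x j i : height (walk_from j x) i = height x (j + i) - height x j.
Proof.
elim: i => [|i IH]; first by rewrite addn0 subrr.
by rewrite addnS /= IH /walk_from; ring.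
Qed.

Lemma sarea_from x j i :
  sarea (walk_from j x) i = sarea x (j + i) - sarea x j - height x j *+ i.
Proof.
elim: i => [|i IH]; first by rewrite addn0 subrr mulr0n subr0.
by rewrite addnS /= IH height_from /walk_from mulrS; ring.
Qed.

Lemma hit_from x j i : hit x j -> hit (walk_from j x) i = hit x (j + i).
Proof.
move=> /andP[/eqP hj /eqP aj].
by rewrite /hit height_from sarea_from hj aj mul0rn !subr0.
Qed.

Lemma hits_add x j i : hit x j -> hits x (j + i) = (hits x j + hits (walk_from j x) i)%N.
Proof.
move=> hj; elim: i => [|i IH]; first by rewrite /hits big_ord0 !addn0.
by rewrite addnS /hits !big_ord_recr /= -!/(hits _ _) IH -addnS hit_from // addnA.
Qed.

Lemma nnloop_hit x k : nnloop x k -> hit x k. Proof. by case/andP. Qed.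

Lemma hits_gt0 x k : (0 < k)%N -> hit x k -> (0 < hits x k)%N.
Proof. by case: k => // k _ hk; rewrite /hits big_ord_recr /= hk addn1. Qed.

Lemma nnloop_add x j i : hit x j -> nnloop x (j + i) = nnloop x j && nnloop (walk_from j x) i.
Proof.
move=> hj; have /andP[/eqP hj0 /eqP aj0] := hj.
apply/nnloopP/andP => [[hk H]|[/nnloopP[_ Hj]] /nnloopP[hi Hi]]; split.
- by apply/nnloopP; split=> // l lj; apply: H; apply: leq_trans lj (leq_addr _ _).
- apply/nnloopP; rewrite hit_from //; split=> // l li.
  rewrite height_from sarea_from hj0 aj0 mul0rn !subr0 => hl.
  by apply: H => //; rewrite leq_add2l.
- by rewrite -hit_from.
move=> l lji hl; have [lj|jl] := leqP l j; first exact: Hj.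
have {lji} : (l - j <= i)%N by rewrite leq_subLR.
move/Hi; rewrite height_from sarea_from hj0 aj0 mul0rn !subr0 subnKC ?(ltnW jl) //.
by apply.
Qed.

(* The unique nonzero term of the sum is the first return. *)
Lemma nnloop_split x k m :
  (nnloop x k && (hits x k == m.+1) : nat) =
  (\sum_(i < k) [&& nnloop x i.+1, hits x i.+1 == 1,
     nnloop (walk_from i.+1 x) (k - i.+1) & hits (walk_from i.+1 x) (k - i.+1) == m])%N.
Proof.
pose Q i := [&& nnloop x i.+1, hits x i.+1 == 1%N,
     nnloop (walk_from i.+1 x) (k - i.+1) & hits (walk_from i.+1 x) (k - i.+1) == m].
have Q_uniq i j : (i < j)%N -> Q i -> Q j -> False.
  move=> ij /and4P[gi hi _ _] /and4P[gj hj _ _].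
  have ijE : j.+1 = (i.+1 + (j - i))%N by lia.
  have := hits_add (j - i) (nnloop_hit gi); rewrite -ijE (eqP hi) (eqP hj).
  suff : (0 < hits (walk_from i.+1 x) (j - i))%N by lia.
  apply: hits_gt0; first by rewrite subn_gt0.
  by rewrite hit_from -?ijE; apply: nnloop_hit.
have Q_nnloop i : (i < k)%N -> Q i -> nnloop x k && (hits x k == m.+1).
  move=> ik /and4P[gi hi gl hl].
  rewrite -(subnKC ik) nnloop_add ?nnloop_hit // hits_add ?nnloop_hit // gi gl /=.
  by rewrite (eqP hi) (eqP hl).
case: (boolP (nnloop x k && _)) => [/andP[gk hk]|ng]; last first.
  by rewrite big1 // => i _; apply/eqP; rewrite eqb0; apply: contra ng; apply: Q_nnloop.
have ex : exists i, hit x i.+1 && (i < k)%N.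
  move: (eqP hk); rewrite /hits => E.
  have : (0 < \sum_(i < k) hit x i.+1)%N by rewrite E.
  rewrite lt0n sum_nat_eq0 negb_forall => /existsP[i]; rewrite implyTb eqb0 negbK => hi.
  by exists i; rewrite hi ltn_ord.
case: (ex_minnP ex) => i /andP[hi ik] imin.
have hi1 : hits x i.+1 = 1%N.
  rewrite /hits big_ord_recr /= hi big1 // => j _; apply/eqP; rewrite eqb0.
  apply/negP => hj; have := imin j; rewrite hj (ltn_trans (ltn_ord j) ik) => /(_ isT).
  by rewrite leqNgt ltn_ord.
have Qi : Q i.
  have := gk; rewrite -(subnKC ik) nnloop_add // => /andP[gi gl].
  move: hk; rewrite -{1}(subnKC ik) hits_add // hi1 => hk.
  by rewrite /Q gi hi1 gl /=; move: hk; rewrite add1n eqSS.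
rewrite (bigD1 (Ordinal ik)) //= -/(Q i) Qi big1 // => j ji.
apply/eqP; rewrite eqb0 -/(Q j); apply/negP => Qj.
have : (j : nat) != i by apply: contraNneq ji => E; apply/eqP/val_inj.
by rewrite neq_ltn => /orP[/Q_uniq|/Q_uniq]; apply.
Qed.

(** * Rotations of a bridge, seen as shifts of its periodic extension *)

Section Periodic.
Variables (x : nat -> int) (k : nat).
Hypothesis k0 : (0 < k)%N.
Hypothesis per : forall i, x (i + k)%N = x i.
Hypothesis bridge : height x k = 0.

Lemma height_per i : height x (k + i) = height x i.
Proof.
elim: i => [|i IH]; first by rewrite addn0 bridge.
by rewrite addnS /= IH addnC per.
Qed.

Lemma sarea_per i : sarea x (k + i) = sarea x k + sarea x i.
Proof.
elim: i => [|i IH]; first by rewrite addn0 addr0.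
by rewrite addnS !sareaS -addnS height_per IH -addrA.
Qed.

(** The area after rotation is -k times the height at j, which must therefore vanish. The old
    endpoint then becomes a zero of the rotated path, with area minus that at j, so the area at j is
    both nonnegative and nonpositive. *)
Lemma nnloop_rot j : (j < k)%N -> nnloop x k -> nnloop (walk_from j x) k = hit x j.
Proof.
move=> jk gk; have /nnloopP[/andP[_ /eqP ak] Hk] := gk.
apply/nnloopP/andP => [[/andP[_ a1] H]|[/eqP hj /eqP aj]].
  move: a1; rewrite sarea_from addnC sarea_per ak add0r subrr sub0r oppr_eq0 mulrn_eq0.
  rewrite gtn_eqF //= => /eqP hj; split; first by rewrite hj.
  have := H (k - j)%N (leq_subr _ _); rewrite height_from sarea_from subnKC ?(ltnW jk) //.
  rewrite bridge hj subrr ak mul0rn subr0 sub0r => /(_ erefl) a1.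
  by have := Hk j (ltnW jk) hj; rewrite eq_le => ->; rewrite -oppr_ge0 a1.
have hj' : hit x j by rewrite /hit hj aj !eqxx.
split.
  by rewrite hit_from // /hit addnC height_per sarea_per hj ak aj addr0 eqxx.
move=> i ik; rewrite height_from sarea_from hj aj mul0rn !subr0 => hl.
have [le|lt] := leqP (j + i) k; first exact: Hk.
move: hl; rewrite -(subnKC (ltnW lt)) height_per sarea_per ak add0r; apply: Hk; lia.
Qed.

Lemma hits_rot : nnloop x k -> hits x k = (\sum_(j < k) nnloop (walk_from j x) k)%N.
Proof.
move=> gk; transitivity (\sum_(j < k) hit x j)%N; last first.
  by apply: eq_bigr => j _; rewrite nnloop_rot.
(* [hits] looks at times 1 to k and the rotations at 0 to k - 1; both ends are hits. *)
rewrite /hits; case: k k0 bridge gk => // k' _ _ gk.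
by rewrite big_ord_recr big_ord_recl /= (nnloop_hit gk) addnC.
Qed.

(** Steps of size at most 1 cannot jump over q, so a path missing q would stay strictly on one side
    of its own average. *)
Lemma average_level (q : int) : (forall i, `|x i| <= 1) -> sarea x k = q *+ k ->
  exists2 j, (j < k)%N & height x j = q.
Proof.
move=> x1 aq; suff /existsP[j /eqP hj] : [exists j : 'I_k, height x j == q] by exists j.
apply: contraT => /existsPn no.
have {}no j : height x j != q.
  elim/ltn_ind: j => j IH; have [jk|kj] := ltnP j k; first exact: (no (Ordinal jk)).
  by rewrite -(subnKC kj) height_per; apply: IH; lia.
have const s : height x 0 < q -> height x s < q.
  move=> H; elim: s => // s IH; have := no s.+1; have := x1 s; rewrite /=; lia.
have const' s : q < height x 0 -> q < height x s.
  move=> H; elim: s => // s IH; have := no s.+1; have := x1 s; rewrite /=; lia.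
have [lt|gt|E] := ltgtP (height x 0) q; last by have := no 0%N; rewrite E eqxx.
  suff : sarea x k < q *+ k by rewrite aq ltxx.
  case: k k0 => // k' _; elim: k' => [|l IH].
    by have := const 1%N lt; rewrite /= mulr1n; lia.
  by rewrite mulrSr sareaS ltrD // const.
suff : q *+ k < sarea x k by rewrite aq ltxx.
case: k k0 => // k' _; elim: k' => [|l IH].
  by have := const' 1%N gt; rewrite /= mulr1n; lia.
by rewrite mulrSr sareaS ltrD // const'.
Qed.

(** [B] is periodic because q is the average height. Restarted at height q, the path has increments
    of [B] as areas, so minimality of [B] among the visits to q is nonnegativity at the zeros. *)
Lemma exists_nnloop_rot (q : int) : (forall i, `|x i| <= 1) -> sarea x k = q *+ k ->
  exists2 j, (j < k)%N & nnloop (walk_from j x) k.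
Proof.
move=> x1 aq; have [j0 j0k hj0] := average_level x1 aq.
(* the area measured from height q *)
pose B i := sarea x i - q *+ i.
have Bper i : B (k + i)%N = B i by rewrite /B sarea_per aq mulrnDr; ring.
case: (@arg_minP _ _ _ (Ordinal j0k) (fun j : 'I_k => height x j == q) (fun j : 'I_k => B j)).
  by rewrite /= hj0.
move=> j /eqP hj jmin; exists j => //; apply/nnloopP.
have BE i : sarea (walk_from j x) i = B (j + i)%N - B j.
  by rewrite sarea_from /B hj mulrnDr; ring.
have jmin' i : height x i = q -> B j <= B i.
  elim/ltn_ind: i => i IH; have [ik hi|ki] := ltnP i k.
    by apply: (jmin (Ordinal ik)); apply/eqP.
  by rewrite -(subnKC ki) height_per Bper; apply: IH; lia.
split.
  by rewrite /hit BE height_from addnC height_per Bper !subrr !eqxx.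
move=> i ik; rewrite height_from hj => /eqP; rewrite subr_eq0 => /eqP /jmin'.
by rewrite BE subr_ge0.
Qed.

End Periodic.
End Walks.

Lemma card_tuple_split (S : finType) a b (P Q : pred (seq S)) :
  #|[set w : (a + b).-tuple S | P (take a w) && Q (drop a w)]| =
  (#|[set u : a.-tuple S | P u]| * #|[set v : b.-tuple S | Q v]|)%N.
Proof.
rewrite -cardsX.
rewrite -(card_in_imset
  (f := fun x : a.-tuple S * b.-tuple S => [tuple of x.1 ++ x.2])); last first.
  move=> [u v] [u' v'] _ _ /(congr1 val) /= /eqP.
  rewrite eqseq_cat ?size_tuple // => /andP[/eqP E /eqP E'].
  by congr pair; apply: val_inj.
apply: eq_card => w; rewrite !inE; apply/andP/imsetP => [[Pw Qw]|[[u v]]].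
  have s1 : size (take a w) == a by rewrite size_takel // size_tuple leq_addr.
  have s2 : size (drop a w) == b by rewrite size_drop size_tuple addKn.
  exists (Tuple s1, Tuple s2); first by rewrite !inE /= Pw Qw.
  by apply: val_inj; rewrite /= cat_take_drop.
rewrite !inE /= => /andP[Pu Qv] -> /=.
by rewrite take_size_cat ?drop_size_cat ?size_tuple // Pu Qv.
Qed.

Lemma sum_periodic (k : nat) (f : nat -> nat) i : (forall j, f (j + k)%N = f j) ->
  (\sum_(j < k) f (i + j) = \sum_(j < k) f j)%N.
Proof.
move=> per; elim: i => [|i IH]; first by apply: eq_bigr.
rewrite -IH; case: k per {IH} => [|k] per; first by rewrite !big_ord0.
rewrite big_ord_recr [RHS]big_ord_recl /= addn0 addnC; congr (_ + _)%N.
  by rewrite addSnnS per.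
by apply: eq_bigr => j _; rewrite addSnnS.
Qed.

Notation step := (bool * bool)%type.

Definition steps (w : seq step) i : int := (bits (nth (false, false) w i))%:Z - 1.

Lemma steps_take w i j : (j < i)%N -> steps (take i w) j = steps w j.
Proof. by move=> ji; rewrite /steps nth_take. Qed.

Lemma steps_drop w i j : steps (drop i w) j = walk_from i (steps w) j.
Proof. by rewrite /steps nth_drop. Qed.

Definition num_nnloop m k :=
  #|[set w : k.-tuple step | nnloop (steps w) k && (hits (steps w) k == m)]|.

Lemma num_nnloop_split a b k m : k = (a + b)%N ->
  #|[set w : k.-tuple step | [&& nnloop (steps w) a, hits (steps w) a == 1%N,
      nnloop (walk_from a (steps w)) b & hits (walk_from a (steps w)) b == m]]| =
  (num_nnloop 1 a * num_nnloop m b)%N.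
Proof.
move=> ->; rewrite -(@card_tuple_split _ _ _
  (fun u => nnloop (steps u) a && (hits (steps u) a == 1%N))
  (fun v => nnloop (steps v) b && (hits (steps v) b == m))).
apply: eq_card => w; rewrite !inE -andbA.
have e1 i : (i < a)%N -> steps w i = steps (take a w) i by move=> ia; rewrite steps_take.
have e2 i : (i < b)%N -> walk_from a (steps w) i = steps (drop a w) i by rewrite steps_drop.
by rewrite (nnloop_ext e1) (hits_ext e1) (nnloop_ext e2) (hits_ext e2).
Qed.

(** Cutting at the first return gives the convolution from which the powers of [rho] arise. *)
Lemma num_nnloopS m k :
  num_nnloop m.+1 k = (\sum_(i < k) num_nnloop 1 i.+1 * num_nnloop m (k - i.+1))%N.
Proof.
rewrite {1}/num_nnloop -sum1_card big_mkcond /=.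
pose Q (w : k.-tuple step) i := [&& nnloop (steps w) i.+1, hits (steps w) i.+1 == 1%N,
     nnloop (walk_from i.+1 (steps w)) (k - i.+1) &
     hits (walk_from i.+1 (steps w)) (k - i.+1) == m].
transitivity (\sum_(w : k.-tuple step) \sum_(i < k) Q w i)%N.
  apply: eq_bigr => w _; rewrite inE -nnloop_split; by case: (_ && _).
rewrite exchange_big /=; apply: eq_bigr => i _.
rewrite -(@num_nnloop_split _ _ k) ?subnKC // -sum1_card [RHS]big_mkcond /=.
by apply: eq_bigr => w _; rewrite inE -/(Q w i); case: (Q w i).
Qed.

Lemma num_nnloop0 k : num_nnloop 0 k = (k == 0)%N.
Proof.
rewrite /num_nnloop; case: k => [|k].
  rewrite (_ : [set _ | _] = setT) ?cardsT ?card_tuple ?expn0 //.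
  by apply/setP => w; rewrite !inE /nnloop /hits /hit big_ord0 /= eqxx.
apply/eqP; rewrite cards_eq0; apply/eqP/setP => w; rewrite !inE.
by apply/negP => /andP[/nnloop_hit/(hits_gt0 (ltn0Sn k))]; rewrite lt0n => /negPf ->.
Qed.

Lemma num_nnloop_gt m k : (k < m)%N -> num_nnloop m k = 0%N.
Proof.
move=> km; apply/eqP; rewrite cards_eq0; apply/eqP/setP => w; rewrite !inE.
apply/negP => /andP[_ /eqP E]; move: km; rewrite -E ltnNge /hits.
by rewrite -[X in (_ <= X)%N]card_ord -sum1_card leq_sum // => i _; apply: leq_b1.
Qed.

Definition residue_tuples k : {set k.-tuple step} :=
  [set w : k.-tuple step | (height (steps w) k == 0) && (k %| sarea (steps w) k)%Z].

Lemma heightE x k : height x k = \sum_(i < k) x i.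
Proof. by elim: k => [|k IH]; rewrite ?big_ord0 // big_ord_recr /= IH. Qed.

(** The step made at time i is counted in the k - i heights that follow it. *)
Lemma sareaE x k : sarea x k = height x k *+ k - \sum_(i < k) x i *+ i.
Proof.
elim: k => [|k IH]; first by rewrite big_ord0 subr0.
by rewrite big_ord_recr sareaS IH /= !mulrS mulrnDl; ring.
Qed.

(** For a bridge the area is minus the sum of i times step i; the shift by 1 in [steps] accounts for
    the sum of the i on the other side of the congruence. *)
Lemma residue_tuplesE k (w : {ffun 'I_k -> step}) :
  ([tuple w i | i < k] \in residue_tuples k) = (w \in residue_words k).
Proof.
rewrite !inE; set x := steps _.
have xE (i : 'I_k) : x i = (bits (w i))%:Z - 1.
  by rewrite /x /steps (nth_mktuple w (false, false) i).
have hE : height x k = (\sum_i bits (w i))%N%:Z - k%:Z.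
  rewrite heightE (eq_bigr _ (fun i _ => xE i)) big_split /= sumrN sumr_const card_ord.
  by rewrite (big_morph Posz PoszD (erefl (Posz 0))) natz.
rewrite hE subr_eq0 eqz_nat; case: eqP => //= E.
rewrite sareaE hE E subrr mul0rn sub0r rpredN.
have -> : \sum_(i < k) x i *+ i =
    (\sum_(i < k) i * bits (w i))%N%:Z - (\sum_(i < k) i)%N%:Z.
  rewrite !(big_morph Posz PoszD (erefl (Posz 0))) -sumrB; apply: eq_bigr => i _.
  by rewrite xE mulrnBl PoszM natz -mulr_natr natz mulrC.
by rewrite -eqz_mod_dvd !modz_nat eqz_nat.
Qed.

Lemma card_residue_tuples k : #|residue_tuples k| = #|residue_words k|.
Proof.
rewrite -(card_in_imset (f := fun w : {ffun 'I_k -> step} => [tuple w i | i < k])); last first.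
  move=> u v _ _ E; apply/ffunP => i.
  by have := congr1 (fun t => tnth t i) E; rewrite !tnth_mktuple.
apply: eq_card => w; apply/idP/imsetP => [wR|[u uR ->]]; last by rewrite residue_tuplesE.
have wE : w = [tuple [ffun i => tnth w i] i | i < k].
  by apply: eq_from_tnth => i; rewrite tnth_mktuple ffunE.
by exists [ffun i => tnth w i]; rewrite // -residue_tuplesE -wE.
Qed.

Section CycleLemma.
Variable (R : numFieldType) (k : nat).
Hypothesis k0 : (0 < k)%N.
Implicit Type w : k.-tuple step.

Let per w i := steps w (i %% k).

Let perP w i : per w (i + k)%N = per w i.
Proof. by rewrite /per modnDr. Qed.

Let per_steps w i : (i < k)%N -> per w i = steps w i.
Proof. by move=> ik; rewrite /per modn_small. Qed.

Let per_rot w j i : (j < k)%N -> per [tuple of rot j w] i = walk_from j (per w) i.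
Proof.
move=> jk; rewrite /per /walk_from /steps /= /rot nth_cat size_drop size_tuple nth_drop.
have lk := ltn_pmod i k0; rewrite -[in RHS]modnDmr; move: lk; set l := (i %% k)%N => lk.
case: ltnP => [lt|ge]; first by rewrite modn_small //; lia.
rewrite nth_take; last by lia.
by rewrite (_ : (j + l)%N = (l - (k - j) + k)%N) ?modnDr ?modn_small //; lia.
Qed.

Let num_rot w := (\sum_(j < k) nnloop (walk_from j (per w)) k)%N.

Let nnloop_rotE w j : (j < k)%N ->
  nnloop (steps [tuple of rot j w]) k = nnloop (walk_from j (per w)) k.
Proof.
by move=> jk; apply: nnloop_ext => i ik; rewrite -per_rot // per_steps.
Qed.

(** The number of returns is the number of good starting indices, which is the same for every
    rotation of w. *)
Let hits_rotE w j : (j < k)%N -> height (steps w) k = 0 ->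
  nnloop (steps [tuple of rot j w]) k -> hits (steps [tuple of rot j w]) k = num_rot w.
Proof.
move=> jk b; set u := [tuple of rot j w] => gu.
have E i : (i < k)%N -> steps u i = per u i by move=> ik; rewrite per_steps.
rewrite (nnloop_ext E) in gu; rewrite (hits_ext E) (hits_rot k0 (perP u)) //; last first.
  by have /andP[/andP[/eqP]] := gu.
rewrite /num_rot.
rewrite -(@sum_periodic k (fun i => nnloop (walk_from i (per w)) k) j) => [|i]; last first.
  by congr nat_of_bool; apply: nnloop_ext => l _; rewrite /walk_from addnAC perP.
apply: eq_bigr => i _; congr nat_of_bool; apply: nnloop_ext => l _.
by rewrite /walk_from per_rot // /walk_from addnA.
Qed.

Let weight w : R := (nnloop (steps w) k)%:R / (hits (steps w) k)%:R.

(** There are [num_rot w] good starting indices, at least one, each of weight 1 over [num_rot w]. *)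
Let weight_rot w : w \in residue_tuples k ->
  \sum_(j < k) weight [tuple of rot j w] = 1.
Proof.
rewrite inE => /andP[/eqP b /dvdzP[q qE]].
have E i : (i < k)%N -> steps w i = per w i by move=> ik; rewrite per_steps.
transitivity (\sum_(j < k) (nnloop (walk_from j (per w)) k)%:R / (num_rot w)%:R : R).
  apply: eq_bigr => j _; rewrite /weight -nnloop_rotE //.
  by case: (boolP (nnloop _ k)) => [/(hits_rotE (ltn_ord j) b) ->//|_]; rewrite !mul0r.
rewrite -mulr_suml -natr_sum divff // pnatr_eq0 -lt0n.
have b1 i : `|per w i| <= 1 by rewrite /per /steps /bits; case: (nth _ _ _) => [[] []].
rewrite (height_ext E) in b; rewrite (sarea_ext E) in qE.
have [|j jk gj] := exists_nnloop_rot k0 (perP w) b b1 (q := q).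
  by rewrite qE -mulr_natr natz.
by rewrite /num_rot (bigD1 (Ordinal jk)) //= gj.
Qed.

Let residue_rot w j : (j < k)%N ->
  w \in residue_tuples k -> [tuple of rot j w] \in residue_tuples k.
Proof.
move=> jk; rewrite !inE => /andP[/eqP b /dvdzP[q qE]].
have E i : (i < k)%N -> steps w i = per w i by move=> ik; rewrite per_steps.
have E' i : (i < k)%N -> steps [tuple of rot j w] i = walk_from j (per w) i.
  by move=> ik; rewrite -per_rot // per_steps.
rewrite (height_ext E) in b; rewrite (sarea_ext E) in qE.
rewrite (height_ext E') (sarea_ext E') height_from sarea_from addnC.
rewrite (height_per (perP w)) // (sarea_per (perP w)) // subrr eqxx /= addrK qE.
by rewrite -mulr_natr natz -mulrBl dvdz_mull.
Qed.

(** Double counting of pairs of a tuple and a starting index: each rotation permutes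
    [residue_tuples], so the total weight is k times the left-hand sum, and by [weight_rot] it is
    also the number of tuples. *)
Lemma cycle_lemma :
  \sum_(w : k.-tuple step | nnloop (steps w) k) (hits (steps w) k)%:R^-1 =
  #|residue_tuples k|%:R / k%:R :> R.
Proof.
have kR : k%:R != 0 :> R by rewrite pnatr_eq0 -lt0n.
apply: (mulfI kR); rewrite mulrC [RHS]mulrC divfK //.
have gr w : nnloop (steps w) k -> w \in residue_tuples k.
  by case/andP => /andP[/eqP h /eqP a] _; rewrite inE h a eqxx dvdz0.
transitivity (\sum_(j < k) \sum_(w in residue_tuples k) weight [tuple of rot j w]).
  rewrite [RHS](eq_bigr (fun=>
    \sum_(w : k.-tuple step | nnloop (steps w) k) (hits (steps w) k)%:R^-1)).
    by rewrite sumr_const card_ord mulr_natr.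
  move=> j _.
  have rotK : injective (fun w => [tuple of rot j w]).
    by move=> u v /(congr1 val) /= /rot_inj /val_inj.
  transitivity (\sum_(w in residue_tuples k) weight w).
    rewrite [RHS](reindex_inj rotK) /=; apply: eq_bigl => w.
    have sub : (fun w => [tuple of rot j w]) @: residue_tuples k \subset residue_tuples k.
      by apply/subsetP => _ /imsetP[u uR ->]; apply: residue_rot.
    have {}sub : (fun w => [tuple of rot j w]) @: residue_tuples k = residue_tuples k.
      by apply/eqP; rewrite eqEcard sub card_imset /=.
    by rewrite -[in RHS]sub (mem_imset _ _ rotK).
  rewrite (bigID (fun w => nnloop (steps w) k)) /= [X in _ + X]big1 ?addr0; last first.
    by move=> w /andP[_ /negbTE ng]; rewrite /weight ng mul0r.
  apply: eq_big => [w|w /andP[_ gw]]; last by rewrite /weight gw mul1r.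
  by case: (boolP (nnloop _ k)) => [/gr ->|]; rewrite ?andbF.
rewrite exchange_big /= (eq_bigr (fun=> 1)) => [|w wR]; last exact: weight_rot.
by rewrite sumr_const.
Qed.

End CycleLemma.

Lemma sum_num_nnloop (R : numFieldType) k : (0 < k)%N ->
  \sum_(1 <= m < k.+1) (num_nnloop m k)%:R / m%:R = #|residue_words k|%:R / k%:R :> R.
Proof.
move=> k0; rewrite -card_residue_tuples -cycle_lemma //.
pose h (w : k.-tuple step) := hits (steps w) k.
transitivity (\sum_(1 <= m < k.+1)
    \sum_(w : k.-tuple step | nnloop (steps w) k) if h w == m then (m%:R^-1 : R) else 0).
  apply: eq_bigr => m _; rewrite -big_mkcondr sumr_const -[RHS]mulr_natl; congr (_%:R * _).
  by apply: eq_card => w; rewrite !inE.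
rewrite exchange_big /=; apply: eq_bigr => w gw.
have h0 : (0 < h w)%N by apply: hits_gt0 => //; apply: nnloop_hit.
have hk : (h w < k.+1)%N.
  rewrite ltnS /h /hits -[X in (_ <= X)%N]card_ord -sum1_card leq_sum // => i _.
  exact: leq_b1.
rewrite (bigD1_seq (h w)) ?mem_index_iota ?iota_uniq ?h0 //= eqxx big1 ?addr0 // => m.
by rewrite eq_sym => /negbTE ->.
Qed.

Local Close Scope ring_scope.

(** * Plane trees as necklaces *)

From mathcomp Require Import boolp.
Require Import Defs.

(** Both images are in bijection with the image of the pair map. It is used to pass from classes of
    [plane_iso] to sets of codes. *)
Lemma card_imset_kernel (T A B : finType) (f : T -> A) (g : T -> B) (D : {set T}) :
  {in D &, forall x y, (f x == f y) = (g x == g y)} -> #|f @: D| = #|g @: D|.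
Proof.
move=> H; set k := fun x => (f x, g x).
have -> : f @: D = fst @: (k @: D) by rewrite -imset_comp.
have -> : g @: D = snd @: (k @: D) by rewrite -imset_comp.
transitivity #|k @: D|; [|symmetry]; apply: card_in_imset.
  move=> _ _ /imsetP[x xD ->] /imsetP[y yD ->] /= E.
  by congr pair => //; apply/eqP; rewrite -H // E.
move=> _ _ /imsetP[x xD ->] /imsetP[y yD ->] /= E.
by congr pair => //; apply/eqP; rewrite H // E.
Qed.

Section Codes.
Variable n' : nat.
Local Notation n := n'.+1.
Local Notation V := 'I_n.+1.
Local Notation word := {ffun 'I_n'.*2.+2 -> bool}.
Implicit Types (G H : rooted_map n) (w : word).

Definition tree_of G h := plane_tree_with (root_vertex G) (nbr G) (rot G) h.

(* w is the word of ups and downs along the contour of G, from some edge d. *)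
Definition codes G w := exists h d, [/\ tree_of G h, dart (nbr G) d &
  forall i : 'I_n'.*2.+2, w i = ascending h (iter i (contour_step (rot G)) d)].

Lemma cardV1 : 1 < #|V|. Proof. by rewrite card_ord. Qed.

Let cardV : (#|V|.-1).*2 = n'.*2.+2. Proof. by rewrite card_ord. Qed.

Lemma plane_treesP G : reflect (is_tree G /\ is_rotation_system G) (G \in plane_trees n).
Proof. by rewrite inE; apply: asboolP. Qed.

Lemma tree_of_plane_tree G : G \in plane_trees n -> exists h, tree_of G h.
Proof.
move/plane_treesP => [[s i c a] R].
by have [p [h pd]] := tree_parent_depth (root_vertex G) s i c a; exists h; split => //; exists p.
Qed.

Lemma tree_of_uniq G h h' : tree_of G h -> tree_of G h' -> h =1 h'.
Proof. by move=> [s R [p pd]] [_ _ [p' pd']]; apply: parent_depth_uniq pd pd'. Qed.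

Lemma codes_rot G w g : codes G w -> codes G (rot_word w g).
Proof.
move=> [h [d [T dd E]]]; exists h, (iter g (contour_step (rot G)) d).
split=> // [|i]; first by apply: dart_iter => //; case: T.
rewrite ffunE E -iterD (iter_contour_mod (i + g) T) // cardV.
by congr (ascending _ (iter _ _ _)).
Qed.

Lemma codes_rot_uniq G w w' : codes G w -> codes G w' -> exists g, w' = rot_word w g.
Proof.
move=> [h [d [T dd E]]] [h' [d' [T' dd' E']]].
have hE := tree_of_uniq T T'.
have [j] := dart_reached T dd dd'; rewrite (iter_contour_mod j T) // cardV => jE.
exists (inZp j); apply/ffunP => i; rewrite ffunE E E' jE -iterD.
rewrite /ascending -!hE (iter_contour_mod (i + _) T) // cardV.
by [].
Qed.

Lemma codes_balanced G w : codes G w -> w \in balanced n'.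
Proof.
move=> [h [d [T dd E]]]; have [s R [p pd]] := T.
rewrite inE; apply/eqP; have := card_ascending s pd; rewrite card_ord /= => <-.
set F := fun i : 'I_n'.*2.+2 => iter i (contour_step (rot G)) d.
rewrite -(card_in_imset (f := F) (D := mem [set i | w i])); last first.
  have ord := order_dart s R pd dd; rewrite cardV in ord.
  move=> i j _ _ FE; apply: val_inj.
  by rewrite /= -(@findex_iter _ (contour_step (rot G)) d i) ?ord // -/(F i) FE findex_iter ?ord.
apply: eq_card => x; rewrite !inE; apply/imsetP/andP => [[i]|[xd xa]].
  by rewrite !inE E => iw ->; split; [apply: dart_iter|].
have [j] := dart_reached T dd xd; rewrite (iter_contour_mod j T) // cardV => jE.
by exists (inZp j) => //; rewrite !inE E /= -jE.
Qed.

Lemma codes_iso G H w : codes G w -> codes H w -> plane_iso G H.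
Proof.
move=> [h [d [T dd E]]] [h' [d' [T' dd' E']]].
have [|f [fr fn ft]] := same_word_iso cardV1 T T' dd dd'.
  by rewrite cardV => i iN; have := E (Ordinal iN); rewrite E'.
apply/existsP; exists f; rewrite fr eqxx /=; apply/andP; split.
  by apply/forallP => v; rewrite fn.
by apply/forallP => v; apply/forallP => u; apply/implyP => uv; rewrite ft.
Qed.

(** An isomorphism commutes with the contour step, and the depth of H pulled back along it is a
    depth for G, hence equal to [h] by uniqueness. *)
Lemma iso_codes G H w : G \in plane_trees n -> H \in plane_trees n ->
  plane_iso G H -> codes G w -> codes H w.
Proof.
move=> _ /tree_of_plane_tree[h' T'] /existsP[f /and3P[/eqP fr /forallP fn /forallP ft]].
move=> [h [d [T dd E]]]; have [s R [p pd]] := T; have [s' R' [p' pd']] := T'.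
have nbE v u : (f u \in nbr H (f v)) = (u \in nbr G v).
  by rewrite (eqP (fn v)) mem_imset //; apply: perm_inj.
have hE : h =1 h' \o f.
  apply: (parent_depth_uniq pd (p' := (f^-1)%g \o p' \o f)).
  case: pd' => h0 hp he; split=> /= [|v vr|v u vu]; first by rewrite fr.
    have fv : f v != root_vertex H by rewrite -fr (inj_eq perm_inj).
    by have [] := hp _ fv; rewrite -nbE permKV.
  rewrite -nbE in vu; have := he _ _ vu; rewrite -fr !(inj_eq perm_inj).
  by case=> -[-> fE]; [left|right]; rewrite -fE permK.
set F := fun x : V * V => (f x.1, f x.2).
have FE i : F (iter i (contour_step (rot G)) d) = iter i (contour_step (rot H)) (F d).
  elim: i => // i IH; rewrite !iterS -IH; set x := iter _ _ _.
  have xd : dart (nbr G) x by apply: dart_iter.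
  rewrite /F /contour_step /=; congr pair; apply/esym/eqP.
  by have /forallP/(_ x.1)/implyP := ft x.2; apply; rewrite s.
exists h', (F d); split=> // [|i]; first by rewrite /dart /= nbE.
by rewrite -FE E /ascending /= !hE.
Qed.

Lemma plane_tree_codes G : G \in plane_trees n -> exists w, codes G w.
Proof.
move/tree_of_plane_tree => [h T]; have [s R [p pd]] := T.
have [u ud] := dart_at s pd (root_vertex G) cardV1.
exists [ffun i : 'I_n'.*2.+2 => ascending h (iter i (contour_step (rot G)) (root_vertex G, u))].
by exists h, (root_vertex G, u); split=> // i; rewrite ffunE.
Qed.

Lemma dyck_codes w : let W i := w (inZp i) in
  (forall i, i <= n.*2 -> i <= (ups W i).*2) -> ups W n.*2 = n ->
  exists2 G, G \in plane_trees n & codes G w.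
Proof.
move=> W dy un.
have plt := pushed_on_lt dy un.
pose par := pushed_on n W.
pose G := RootedMap (finfun (@inc_nb n par)) (finfun (@inc_rot n par)) ord0.
have nE v : nbr G v = @inc_nb n par v by rewrite ffunE.
have rE v : rot G v = @inc_rot n par v by rewrite ffunE.
have aE : adj G =2 (fun v u => u \in @inc_nb n par v) by move=> v u; rewrite /adj nE.
have T : tree_of G (fun v => inc_depth par v).
  rewrite /tree_of (_ : nbr G = @inc_nb n par :> (_ -> _)); last by apply/funext.
  rewrite (_ : rot G = @inc_rot n par :> (_ -> _)); last by apply/funext.
  exact: inc_plane_tree.
exists G.
  apply/plane_treesP; split; last by case: T.
  split=> [||v u|c].
  - by case: T.
  - by move=> v; rewrite aE (inc_nb_irr plt).
  - by rewrite (eq_connect aE) (inc_connect plt).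
  - case: c => // v c H; apply: (inc_acyclic plt).
    move: H; rewrite /ucycle => /andP[cy ->]; rewrite andbT.
    by move: cy; rewrite /= (eq_path aE).
exists (fun v : V => inc_depth par v), (inord (top W 0), inord (top W 1)).
split=> // [|i]; first by rewrite /dart nE; exact: (walk_dart dy un).
have -> : rot G = @inc_rot n par :> (_ -> _) by apply/funext.
have -> : w i = W i by rewrite /W valZpK.
by rewrite (walk_ascending dy un).
Qed.

Lemma ups_rot w (g i : nat) :
  ups (fun j => w (inZp j)) (g + i) =
  ups (fun j => w (inZp j)) g + ups (fun j => w (inZp (g + j))) i.
Proof. by elim: i => [|i IH]; rewrite ?addn0 //= addnS /= IH addnA. Qed.

Lemma ups_balanced w : w \in balanced n' -> ups (fun j => w (inZp j)) n.*2 = n.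
Proof.
rewrite inE => /eqP wn; rewrite -[RHS]wn.
have upsE (W : nat -> bool) i : ups W i = \sum_(j < i) W j.
  by elim: i => [|i IH]; rewrite ?big_ord0 // big_ord_recr /= IH.
rewrite upsE -sum1_card [RHS]big_mkcond /= doubleS; apply: eq_bigr => i _.
by rewrite inE valZpK; case: (w i).
Qed.

Lemma balanced_codes w : w \in balanced n' -> exists2 G, G \in plane_trees n & codes G w.
Proof.
move=> wb; set U := ups (fun j => w (inZp j)); have UN := ups_balanced wb.
(* The minimized quantity is ups minus downs up to g, plus 2 n to stay in [nat]. Starting at its
   minimum makes the word a Dyck word. *)
case: (@arg_minnP _ (ord0 : 'I_n'.*2.+2) predT (fun g => (U g).*2 + (n.*2 - g)) isT) => g _ gmin.
have rotE j : rot_word w g (inZp j) = w (inZp (g + j)).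
  by rewrite ffunE; congr (w _); apply: val_inj; rewrite /= modnDml addnC.
have UE i : ups (fun j => rot_word w g (inZp j)) i = U (g + i) - U g.
  rewrite /U ups_rot addKn; elim: i => //= i ->; by rewrite rotE.
have min i : i <= n.*2 -> (U g).*2 + i <= (U (g + i)).*2.
  move=> iN; have gN : g < n.*2 := ltn_ord g.
  have [lt|ge] := ltnP (g + i) n.*2.
    by have := gmin (Ordinal lt) isT; rewrite /=; lia.
  have lt : g + i - n.*2 < n.*2 by lia.
  have -> : U (g + i) = n + U (g + i - n.*2).
    rewrite -{1}(subnKC ge) /U ups_rot UN; congr (_ + _).
    elim: (_ - _) => //= k ->; congr (_ + w _ : nat); apply: val_inj.
    exact: (modnDl k n'.*2.+2).
  by have := gmin (Ordinal lt) isT; rewrite /=; lia.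
have Umono : U g <= U (g + n.*2) by rewrite /U ups_rot leq_addr.
have [||G GP Gw] := @dyck_codes (rot_word w g).
- move=> i /min; rewrite UE; lia.
- rewrite UE addnC {1}/U ups_rot UN.
  have -> : ups (fun j => w (inZp (n.*2 + j))) g = U g.
    elim: (nat_of_ord g) => //= k ->; congr (_ + w _ : nat); apply: val_inj.
    exact: (modnDl k n'.*2.+2).
  by rewrite addnK.
exists G => //; have := codes_rot (- g)%R Gw.
suff -> : rot_word (rot_word w g) (- g)%R = w by [].
by apply/ffunP => x; rewrite !ffunE addrNK.
Qed.

Definition code_set G : {set word} := [set w : word | `[< codes G w >]].

Lemma code_setE G w : codes G w -> code_set G = orbit (rot_word_action _) [set: 'I_n'.*2.+2] w.
Proof.
move=> Gw; apply/setP => w'; rewrite inE; apply/asboolP/orbitP => [|[g _ <-]].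
  by case/(codes_rot_uniq Gw) => g ->; exists g.
exact: codes_rot.
Qed.

Lemma plane_iso_code_set G H : G \in plane_trees n -> H \in plane_trees n ->
  plane_iso G H = (code_set G == code_set H).
Proof.
move=> GP HP; have [w Gw] := plane_tree_codes GP.
apply/idP/eqP => [iso|E].
  by rewrite (code_setE Gw) (code_setE (iso_codes GP HP iso Gw)).
apply: (codes_iso Gw); apply/asboolP.
by have := orbit_refl (rot_word_action _) [set: 'I_n'.*2.+2] w; rewrite -(code_setE Gw) E inE.
Qed.

Lemma num_plane_trees_orbits : num_plane_trees n =
  #|orbit (rot_word_action _) [set: 'I_n'.*2.+2] @: balanced n'|.
Proof.
transitivity #|code_set @: plane_trees n|.
  rewrite /num_plane_trees /equivalence_partition.
  apply: card_imset_kernel => G H GP HP; apply/eqP/eqP => [E|E].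
    have : H \in [set y in plane_trees n | plane_iso H y].
      by rewrite in_set HP plane_iso_code_set // eqxx.
    by rewrite -E in_set HP plane_iso_code_set // => /eqP.
  apply/setP => K; rewrite [in LHS]in_set [in RHS]in_set.
  have [KP|//] := boolP (K \in plane_trees n).
  by rewrite !plane_iso_code_set // E.
apply: eq_card => S; apply/imsetP/imsetP => [[G GP ->]|[w wb ->]].
  have [w Gw] := plane_tree_codes GP; exists w; rewrite ?(code_setE Gw) //.
  exact: codes_balanced Gw.
have [G GP Gw] := balanced_codes wb.
by exists G => //; rewrite (code_setE Gw).
Qed.

End Codes.

(** * Series *)

From mathcomp Require Import finmap all_classical all_reals all_analysis.
From mathcomp Require Import measurable_realfun.

Import numFieldNormedType.Exports.

Local Open Scope classical_set_scope.
Local Open Scope ring_scope.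

Section LogSeries.
Variable R : realType.
Implicit Types x : R.

Let log_poly n : {poly R} := \sum_(0 <= m < n) m.+1%:R^-1 *: 'X^(m.+1).

Let log_polyE n x : (log_poly n).[x] = \sum_(0 <= m < n) x ^+ m.+1 / m.+1%:R.
Proof.
by rewrite horner_sum; apply: eq_bigr => m _; rewrite hornerZ hornerXn mulrC.
Qed.

Let deriv_log_poly n x : (1 - x) * (log_poly n)^`().[x] = 1 - x ^+ n.
Proof.
rewrite -[RHS]opprB subrX1 -mulNr opprB; congr (_ * _).
rewrite raddf_sum horner_sum big_mkord; apply: eq_bigr => m _ /=.
rewrite derivZ derivXn hornerZ hornerMn hornerXn mulrnAr -mulrnAl.
by rewrite -[_^-1 *+ _]mulr_natr mulVf ?mul1r.
Qed.

(** The mean value theorem for [F], the logarithm plus its Taylor polynomial: [F] vanishes at 0 and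
    has derivative - y ^ n / (1 - y), so the error is at most a multiple of x ^ n. *)
Lemma cvg_log_series x : 0 <= x < 1 ->
  (fun n => \sum_(0 <= m < n) x ^+ m.+1 / m.+1%:R) @ \oo --> - ln (1 - x).
Proof.
move=> /andP[x0 x1].
have bound n : `| - ln (1 - x) - \sum_(0 <= m < n) x ^+ m.+1 / m.+1%:R | <= x / (1 - x) * x ^+ n.
  rewrite -log_polyE.
  pose F := (fun y : R => ln (1 - y) + (log_poly n).[y]).
  have dF (y : R) : y < 1 -> is_derive y 1 F (- (1 - y)^-1 + (log_poly n)^`().[y]).
    move=> y1; have y1' : 0 < 1 - y by rewrite subr_gt0.
    have d1 : is_derive (1 - y) 1 (@ln R) (1 - y)^-1 by apply: is_derive1_ln.
    have d2 : is_derive y 1 (fun z : R => 1 - z) (- 1).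
      by apply: is_derive_eq; rewrite add0r mul1r.
    have d3 := is_derive1_comp (f := @ln R) (g := fun z : R => 1 - z).
    apply: (@is_deriveD _ _ _ (fun z : R => ln (1 - z)) (horner (log_poly n))).
    by have := d3 y _ _ d1 d2; rewrite mulrN1.
  have [||c] := @MVT_segment R F (fun y => - (1 - y)^-1 + (log_poly n)^`().[y]) 0 x x0.
  - by move=> y; rewrite in_itv /= => /andP[_ yx]; apply: dF; apply: lt_trans x1.
  - apply: derivable_within_continuous => y; rewrite in_itv /= => /andP[_ yx].
    by apply: ex_derive; apply: dF; apply: le_lt_trans x1.
  rewrite in_itv /= => /andP[c0 cx]; rewrite /F !subr0 ln1 add0r.
  have -> : (log_poly n).[0] = 0.
    by rewrite log_polyE big1 // => i _; rewrite exprS mul0r mul0r.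
  rewrite subr0 => E.
  have c1 : 0 < 1 - c by rewrite subr_gt0 (le_lt_trans cx).
  have dE : - (1 - c)^-1 + (log_poly n)^`().[c] = - (c ^+ n / (1 - c)).
    apply: (mulfI (lt0r_neq0 c1)); rewrite mulrDr deriv_log_poly mulrN divff ?lt0r_neq0 //.
    by rewrite mulrN [_ / _]mulrC mulVKf ?lt0r_neq0 //; ring.
  have q0 : 0 <= c ^+ n / (1 - c) by rewrite mulr_ge0 ?exprn_ge0 ?invr_ge0 ?(ltW c1).
  rewrite -opprD normrN E dE normrM normrN (ger0_norm q0) (ger0_norm x0).
  rewrite mulrC -mulrA ler_wpM2l // mulrC.
  apply: ler_pM; rewrite ?exprn_ge0 ?invr_ge0 ?(ltW c1) //.
    by rewrite lef_pV2 ?posrE ?lerB // subr_gt0.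
  by rewrite lerXn2r ?nnegrE.
have x1n : `|x| < 1 by rewrite ger0_norm.
apply/cvgrPdist_le => e e0.
have := cvg_geometric (x / (1 - x)) x1n.
move/cvgrPdist_le => /(_ e e0); apply: filterS => n; rewrite sub0r normrN /=.
by move=> /(le_trans (ler_norm _)); apply: le_trans; exact: bound.
Qed.

End LogSeries.

Section Series.
Local Open Scope ereal_scope.
Variable R : realType.

Lemma nneseries_finite (f : nat -> \bar R) n :
  (forall k, 0 <= f k) -> (forall k, (n <= k)%N -> f k = 0) ->
  \sum_(k <oo) f k = \sum_(k < n) f k.
Proof.
move=> f0 fn; rewrite (@nneseries_split _ _ 0%N n) ?add0n // big_mkord.
by rewrite [X in _ + X]eseries0 ?adde0 // => i ni _; apply: fn.
Qed.

Lemma nneseries_shift (f : nat -> \bar R) n :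
  (forall k, 0 <= f k) -> (forall k, (k < n)%N -> f k = 0) ->
  \sum_(k <oo) f (k + n)%N = \sum_(k <oo) f k.
Proof.
move=> f0 fn; rewrite nneseries_addn // (@nneseries_split _ _ 0%N n) ?add0n // big_mkord.
by rewrite big1 ?add0e // => i _; apply: fn.
Qed.

(** Tonelli for nonnegative terms. [a i] stands for index i + 1, since a first return takes at least
    one step. *)
Lemma cauchy_product (a q : nat -> R) (s : R) :
  (forall i, 0 <= a i)%R -> (forall i, 0 <= q i)%R ->
  \sum_(i <oo) (q i)%:E = s%:E ->
  \sum_(k <oo) (\sum_(i < k) a i * q (k - i.+1)%N)%R%:E = s%:E * \sum_(i <oo) (a i)%:E.
Proof.
move=> a0 q0 qs.
pose f (k i : nat) := if (i < k)%N then (a i * q (k - i.+1)%N)%:E else 0%E.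
have f0 k i : 0 <= f k i by rewrite /f; case: ifP => // _; rewrite lee_fin mulr_ge0.
transitivity (\sum_(k <oo) \sum_(i <oo) f k i).
  apply: eq_eseriesr => k _; rewrite (@nneseries_finite _ k) //; last first.
    by move=> i ki; rewrite /f ltnNge ki.
  by rewrite -sumEFin; apply: eq_bigr => i _; rewrite /f ltn_ord.
rewrite nneseries_interchange // -nneseriesZl; last by move=> i _; rewrite lee_fin.
apply: eq_eseriesr => i _.
rewrite -(@nneseries_shift _ i.+1) //; last by move=> k; rewrite /f ltnS => ki; rewrite ltnNge ki.
rewrite muleC -qs -nneseriesZl; last by move=> j _; rewrite lee_fin.
by apply: eq_eseriesr => j _; rewrite /f addnS ltnS leq_addl subSS addnK EFinM.
Qed.

Definition nnloop_freq m k : R := ((num_nnloop m k)%:R / 4 ^+ k)%R.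

Lemma nnloop_freq_ge0 m k : (0 <= nnloop_freq m k)%R.
Proof. by rewrite divr_ge0. Qed.

Lemma nnloop_freqS m k :
  nnloop_freq m.+1 k = (\sum_(i < k) nnloop_freq 1%N i.+1 * nnloop_freq m (k - i.+1)%N)%R.
Proof.
rewrite /nnloop_freq num_nnloopS natr_sum mulr_suml; apply: eq_bigr => i _.
have -> : (4 ^+ k = 4 ^+ i.+1 * 4 ^+ (k - i.+1) :> R)%R by rewrite -exprD subnKC.
by rewrite natrM invfM mulrACA.
Qed.

Variable p : R.
Hypothesis pE : \sum_(k <oo) (nnloop_freq 1%N k.+1)%:E = p%:E.

Lemma sum_nnloop_freq m : \sum_(k <oo) (nnloop_freq m k)%:E = (p ^+ m)%:E.
Proof.
elim: m => [|m IH].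
  rewrite (@nneseries_finite _ 1%N) => [|k|k k1].
  - by rewrite big_ord1 /nnloop_freq num_nnloop0 expr0 expr0 divr1.
  - by rewrite lee_fin nnloop_freq_ge0.
  - by rewrite /nnloop_freq num_nnloop0 gtn_eqF // mul0r.
under eq_eseriesr do rewrite nnloop_freqS.
have := @cauchy_product (fun i => nnloop_freq 1%N i.+1) (nnloop_freq m) (p ^+ m).
move=> -> //; first by rewrite pE -EFinM exprSr.
all: by move=> i; apply: nnloop_freq_ge0.
Qed.

Hypothesis p0 : (0 <= p)%R.
Hypothesis p1 : (p < 1)%R.

(** By [sum_num_nnloop] each term is a finite sum over the number m + 1 of returns; exchanging the
    two sums leaves p ^ (m + 1) / (m + 1), the logarithmic series. *)
Lemma cvg_residue_series :
  (fun n => \sum_(0 <= k < n) #|residue_words k.+1|%:R / k.+1%:R / 4 ^+ k.+1 : R)%R @ \oo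
    --> (- ln (1 - p))%R.
Proof.
pose u k : R := (#|residue_words k.+1|%:R / k.+1%:R / 4 ^+ k.+1)%R.
have u0 k : (0 <= u k)%R by rewrite !divr_ge0 // exprn_ge0.
suff U : \sum_(k <oo) (u k)%:E = (- ln (1 - p))%:E.
  have : (fun n => \sum_(0 <= k < n) (u k)%:E) @ \oo --> (- ln (1 - p))%:E.
    by rewrite -U; apply: is_cvg_nneseries => k _ _; rewrite lee_fin.
  move/fine_cvg; apply: cvg_trans; apply: near_eq_cvg; near=> n.
  by rewrite /= sumEFin.
transitivity (\sum_(m <oo) (p ^+ m.+1 / m.+1%:R)%:E); last first.
  apply/cvg_lim => //; have cl := cvg_log_series (introT andP (conj p0 p1)).
  apply: (@cvg_trans _ ((EFin \o (fun n => \sum_(0 <= m < n) p ^+ m.+1 / m.+1%:R)%R) @ \oo)).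
    by apply: near_eq_cvg; near=> n; rewrite /= sumEFin.
  by apply: cvg_EFin; [near=> n|].
pose f k m := (nnloop_freq m.+1 k.+1 / m.+1%:R)%R%:E.
have f0 k m : 0 <= f k m by rewrite lee_fin divr_ge0 ?nnloop_freq_ge0.
transitivity (\sum_(k <oo) \sum_(m <oo) f k m).
  apply: eq_eseriesr => k _; rewrite (@nneseries_finite _ k.+1) //; last first.
    by move=> m km; rewrite /f /nnloop_freq num_nnloop_gt ?mul0r // ltnS.
  rewrite /f sumEFin /u -sum_num_nnloop // big_add1 /= big_mkord mulr_suml; congr _%:E.
  by apply: eq_bigr => m _; rewrite /nnloop_freq mulrAC.
rewrite nneseries_interchange //; apply: eq_eseriesr => m _.
rewrite mulrC EFinM -sum_nnloop_freq -nneseriesZl; last first.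
  by move=> k _; rewrite lee_fin nnloop_freq_ge0.
rewrite -[RHS](@nneseries_shift _ 1%N) => [|k|k].
- by apply: eq_eseriesr => k _; rewrite /f addn1 -EFinM mulrC.
- by rewrite -EFinM lee_fin mulr_ge0 ?invr_ge0 ?ler0n ?nnloop_freq_ge0.
- by rewrite ltnS leqn0 => /eqP ->; rewrite /nnloop_freq num_nnloop_gt ?mul0r ?mule0.
Unshelve. all: by end_near. Qed.

End Series.

(** * The lazy walk *)

Section FiniteUnion.
Context d (T : measurableType d) (R : realType) (P : probability T R).

Lemma probability_bigcup_fin (I : finType) (F : I -> set T) :
  (forall i, measurable (F i)) -> trivIset setT F ->
  P (\bigcup_i F i) = (\sum_i P (F i))%E.
Proof.
move=> mF tF; have fin : finite_set [set: I] by apply: finite_finset.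
rewrite measure_fin_bigcup // fsbig_finite //=.
apply: perm_big; apply: uniq_perm; rewrite ?fset_uniq ?index_enum_uniq // => i.
by rewrite mem_index_enum in_fset_set // mem_set.
Qed.

(** The events need only cover almost everything: the increments of the walk lie in {-1, 0, 1}
    almost surely, and possibly not everywhere. *)
Lemma probability_partition (I : finType) (F : I -> set T) (E : set T) :
  (forall i, measurable (F i)) -> trivIset setT F ->
  (\sum_i P (F i) = 1)%E -> measurable E -> P E = (\sum_i P (E `&` F i))%E.
Proof.
move=> mF tF F1 mE.
have mU : measurable (\bigcup_i F i).
  by apply: fin_bigcup_measurable => [|i _]; [exact: finite_finset|].
have E0 : P (E `\` \bigcup_i F i) = 0%E.
  apply/eqP; rewrite eq_le measure_ge0 andbT.
  apply: (@le_trans _ _ (P (~` (\bigcup_i F i)))).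
    by apply: le_measure; rewrite ?inE //; [exact: measurableD|exact: measurableC].
  by rewrite probability_setC // probability_bigcup_fin // F1 subee.
have -> : P E = (P (E `\` \bigcup_i F i) + P (E `&` \bigcup_i F i))%E.
  exact: measureDI.
rewrite E0 add0e setI_bigcupr; apply: probability_bigcup_fin.
- by move=> i; apply: measurableI.
- exact: trivIset_setIl.
Qed.

End FiniteUnion.

Section Walk.
Context d (T : measurableType d) (R : realType) (P : probability T R).
Variable Y : nat -> {RV P >-> R}.
Hypothesis hY : lazy_simple_walk Y.

Local Notation inc := (increment Y).

Lemma measurable_increment i : measurable_fun setT (inc i).
Proof. by apply: measurable_funB. Qed.

Lemma measurable_area i : measurable_fun setT (area Y i).
Proof. by apply: measurable_sum => j; apply: measurable_funTS. Qed.

Definition prefix_event k (v : nat -> R) : set T :=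
  [set t | forall i, (i < k)%N -> inc i t = v i].

Lemma prefix_eventE k v :
  prefix_event k v = \bigcap_(i in [set` [fset i in iota 0 k]%fset]) inc i @^-1` [set v i].
Proof.
apply/seteqP; split=> t /= H i.
  by rewrite /= !inE /= mem_iota /= => ik; apply: H.
by move=> ik; apply: H; rewrite /= !inE /= mem_iota.
Qed.

Lemma measurable_prefix_event k v : measurable (prefix_event k v).
Proof.
rewrite prefix_eventE; apply: fin_bigcap_measurable; first exact: finite_fset.
move=> i _; rewrite -[X in measurable X]setTI.
by apply: measurable_increment => //; apply: measurable_set1.
Qed.

Lemma prefix_event_prob k v :
  P (prefix_event k v) = (\prod_(i < k) P (inc i @^-1` [set v i]))%E.
Proof.
case: hY => _ ind _; rewrite prefix_eventE.
rewrite (ind _ (fun i => [set v i])) => [|i]; last exact: measurable_set1.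
rewrite -(big_mkord xpredT (fun i => P (inc i @^-1` [set v i]))).
apply: perm_big; apply: uniq_perm; rewrite ?fset_uniq ?iota_uniq // => i.
by rewrite !inE /= /index_iota subn0.
Qed.

Lemma walk_height k (v : nat -> int) t : prefix_event k (fun i => (v i)%:~R) t ->
  forall j, (j <= k)%N -> Y j t = (height v j)%:~R.
Proof.
case: hY => Y0 _ _ pt; elim=> [|j IH] jk; first by rewrite Y0.
have := pt j jk; rewrite /= rmorphD /= -IH 1?ltnW // => <-.
by rewrite /increment addrC subrK.
Qed.

Lemma areaS j t : area Y j.+1 t = area Y j t + Y j.+1 t.
Proof. by rewrite /area big_nat_recr. Qed.

Lemma walk_area k (v : nat -> int) t : prefix_event k (fun i => (v i)%:~R) t ->
  forall j, (j <= k)%N -> area Y j t = (sarea v j)%:~R.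
Proof.
move=> pt; elim=> [|j IH] jk; first by rewrite /area big_geq.
by rewrite areaS IH 1?ltnW // (walk_height pt jk) sareaS [RHS]rmorphD.
Qed.

Definition first_return k : set T := [set t | [/\ Y k t = 0, area Y k t = 0 &
  forall j, (0 < j < k)%N -> ~ (Y j t = 0 /\ area Y j t <= 0)]].

Lemma tauE k t : (0 < k)%N -> Y k t = 0 -> area Y k t <= 0 ->
  (forall j, (0 < j < k)%N -> ~ (Y j t = 0 /\ area Y j t <= 0)) ->
  tau Y t = (k%:R)%:E.
Proof.
move=> k0 Yk Ak H; apply/eqP; rewrite eq_le; apply/andP; split.
  by apply: ereal_inf_lbound; exists k.
apply: le_ereal_inf_tmp => _ [j [j1 Yj Aj] <-]; rewrite lee_fin ler_nat leqNgt.
by apply/negP => jk; apply: (H j); rewrite ?j1.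
Qed.

Lemma area_tau_eq0E : area_tau_eq0 Y = \bigcup_k first_return k.+1.
Proof.
apply/seteqP; split=> [t [k tk ak]|t [k _ [Yk Ak H]]]; last first.
  by exists k.+1 => //; apply: tauE; rewrite ?Ak.
have [ex|no] := pselect (exists j,
    `[< [/\ (1 <= j)%N, Y j t = 0 & area Y j t <= 0] >]); last first.
  move: tk; rewrite /tau (_ : [set _ | k in _] = set0) ?ereal_inf0 // -subset0.
  by move=> x [j jS _]; apply: no; exists j; apply/asboolP.
case: (ex_minnP ex) => m /asboolP[m1 Ym Am] mmin.
have mH j : (0 < j < m)%N -> ~ (Y j t = 0 /\ area Y j t <= 0).
  move=> /andP[j0 jm] [Yj Aj]; have := mmin j (asboolT (And3 j0 Yj Aj)).
  by rewrite leqNgt jm.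
have := tauE m1 Ym Am mH; rewrite tk => -[/eqP]; rewrite eqr_nat => /eqP km.
rewrite km in ak; exists m.-1 => //; rewrite prednK //; split=> //.
Qed.

Lemma trivIset_first_return : trivIset setT (fun k => first_return k.+1).
Proof.
move=> i j _ _ [t [[Yi Ai Hi] [Yj Aj Hj]]].
by case: (ltngtP i j) => // lt; [case: (Hj i.+1)|case: (Hi j.+1)]; rewrite ?ltnS ?lt // ?Ai ?Aj.
Qed.

Lemma measurable_first_return k : measurable (first_return k).
Proof.
have mY j : measurable (Y j @^-1` [set 0]).
  by rewrite -[X in measurable X]setTI; apply: measurable_funPT => //; apply: measurable_set1.
have -> : first_return k = Y k @^-1` [set 0] `&` area Y k @^-1` [set 0] `&`
    \bigcap_(j in [set j | (0 < j < k)%N]) ~` (Y j @^-1` [set 0] `&` area Y j @^-1` `]-oo, 0]).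
  apply/seteqP; split=> t.
    by move=> [Yk Ak H]; split.
  by move=> [[Yk Ak] H]; split.
have mA j (B : set R) : measurable B -> measurable (area Y j @^-1` B).
  by move=> mB; rewrite -[X in measurable X]setTI; apply: measurable_area.
apply: measurableI; first by apply: measurableI => //; apply: mA; apply: measurable_set1.
apply: bigcap_measurableType => j _; apply: measurableC; apply: measurableI => //.
by apply: mA; apply: measurable_itv.
Qed.

(** Before a first return the area is positive at every zero: nonnegative by [nnloop], and nonzero
    because there is only one hit. *)
Lemma first_return_nnloop (v : nat -> int) k : (0 < k)%N ->
  (hit v k /\ forall j, (0 < j < k)%N -> ~ (height v j = 0 /\ sarea v j <= 0)) <->
  nnloop v k && (hits v k == 1)%N.
Proof.
move=> k0; split=> [[hk H]|/andP[/nnloopP[hk gk] /eqP h1]].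
  apply/andP; split.
    apply/nnloopP; split=> // -[|j] // jk hj; have [->|ne] := eqVneq j.+1 k.
      by case/andP: hk => _ /eqP ->.
    rewrite leNgt; apply/negP => /ltW sj; apply: (H j.+1) => //.
    by rewrite /= ltn_neqAle ne.
  case: k k0 hk H => // k _ hk H; rewrite /hits big_ord_recr /= hk big1 // => i _.
  apply/eqP; rewrite eqb0; apply/negP => /andP[/eqP hi /eqP ai].
  by apply: (H i.+1); rewrite ?ltnS ?ltn_ord // ai.
split=> // j /andP[j0 jk] [hj aj].
have hitj : hit v j by rewrite /hit hj eqxx /= eq_le aj gk // ltnW.
have := hits_add (k - j) hitj; rewrite subnKC ?(ltnW jk) // h1.
have := hits_gt0 j0 hitj; have : (0 < hits (walk_from j v) (k - j))%N.
  by apply: hits_gt0; rewrite ?subn_gt0 // hit_from // subnKC // ltnW.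
lia.
Qed.

Section FirstReturn.
Variable k : nat.

(** The space [T] carries only the three-valued increments, not pairs of bits. Probabilities are
    thus computed over words in 'I_3 and expanded into pairs of bits afterwards, through [wt]. *)
Let val (w : {ffun 'I_k.+1 -> 'I_3}) (i : nat) : int := (w (inord i) : nat)%:Z - 1.

Let F w := prefix_event k.+1 (fun i => (val w i)%:~R).

Let wt (c : 'I_3) : R := \sum_(b : bool * bool | bits b == c) 4^-1.

Let inc_prob i (c : 'I_3) : P (inc i @^-1` [set ((c : nat)%:Z - 1)%:~R]) = (wt c)%:E.
Proof.
case: hY => _ _ /(_ i)[p1 pN p0].
have -> : wt c = \sum_(a : bool) \sum_(b : bool) if (a + b == c)%N then 4^-1 else 0.
  rewrite /wt big_mkcond.
  by rewrite (pair_bigA _ (fun a b : bool => if (a + b == c)%N then 4^-1 else 0)) /=.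
rewrite !big_bool /=; case: c => -[|[|[|//]]] /= _.
- rewrite sub0r rmorphN1 pN; congr _%:E; ring.
- by rewrite subrr p0; congr _%:E; rewrite add0r addr0; field.
- apply: etrans p1 _; congr _%:E; ring.
Qed.

Let F_prob w : P (F w) = (\prod_i wt (w i))%:E.
Proof.
rewrite /F prefix_event_prob -prodEFin; apply: eq_bigr => i _.
by rewrite inc_prob inord_val.
Qed.

Let sum_wt : \sum_c wt c = 1.
Proof.
transitivity (\sum_(b : bool * bool) (4^-1 : R)).
  rewrite (partition_big (fun b => inord (bits b) : 'I_3) xpredT) //=.
  apply: eq_bigr => c _; apply: eq_bigl => b.
  by rewrite -val_eqE /= inordK // /bits; case: b => [[] []].
by rewrite sumr_const card_prod card_bool -[_ *+ _]mulr_natr mulVf.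
Qed.

Let F_total : (\sum_w P (F w) = 1)%E.
Proof.
rewrite (eq_bigr _ (fun w _ => F_prob w)) sumEFin.
rewrite -(bigA_distr_bigA (fun (_ : 'I_k.+1) c => wt c)).
by rewrite big1 // => i _; exact: sum_wt.
Qed.

Lemma first_return_prob : P (first_return k.+1) = (nnloop_freq R 1 k.+1)%:E.
Proof.
have mF w : measurable (F w) by apply: measurable_prefix_event.
have tF : trivIset setT F.
  move=> w w' _ _ [t [Ft Ft']]; apply/ffunP => i; apply: ord_inj.
  have := Ft i (ltn_ord i); rewrite Ft' // => /eqP.
  by rewrite eqr_int /val inord_val (inj_eq (addIr _)) => /eqP[->].
rewrite (probability_partition mF tF F_total) //; last exact: measurable_first_return.
pose pr w := nnloop (val w) k.+1 && (hits (val w) k.+1 == 1)%N.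
have E w : P (first_return k.+1 `&` F w) = (if pr w then \prod_i wt (w i) else 0)%:E.
  have iff t : F w t -> first_return k.+1 t <-> pr w.
    move=> Ft; have [G1 G2] := @first_return_nnloop (val w) k.+1 isT.
    have hE j : (j <= k.+1)%N -> Y j t = (height (val w) j)%:~R by apply: walk_height.
    have aE j : (j <= k.+1)%N -> area Y j t = (sarea (val w) j)%:~R by apply: walk_area.
    split=> [[Yk Ak H]|/G2[/andP[/eqP hk /eqP ak] H]]; first apply: G1; split.
    - move: Yk Ak; rewrite hE // aE // => /eqP + /eqP.
      by rewrite !intr_eq0 /hit => -> ->.
    - move=> j jk [hj aj]; apply: (H j jk).
      have jk' : (j <= k.+1)%N by case/andP: jk => _ /ltnW.
      by rewrite hE // aE // hj lerz0.
    - by rewrite hE // hk.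
    - by rewrite aE // ak.
    - move=> j jk; have jk' : (j <= k.+1)%N by case/andP: jk => _ /ltnW.
      rewrite hE // aE // lerz0 => -[/eqP]; rewrite intr_eq0 => /eqP hj aj.
      exact: (H j jk).
  case: ifP => prw.
    rewrite -F_prob; congr (P _); apply/seteqP; split=> t; first by case.
    by move=> Ft; split=> //; apply/iff.
  rewrite (_ : _ `&` _ = set0) ?measure0 // -subset0 => t [ft Ft].
  by move/(iff t Ft): ft; rewrite prw.
rewrite (eq_bigr _ (fun w _ => E w)) sumEFin; congr _%:E.
(* [c] forgets the bits and keeps the increments; its fibre over a word has as many elements, times
   4 ^ -(k + 1), as the probability of that word. *)
pose c (u : {ffun 'I_k.+1 -> bool * bool}) : {ffun 'I_k.+1 -> 'I_3} :=
  [ffun i => inord (bits (u i))].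
have bits3 b : (bits b < 3)%N by case: b => [[] []].
transitivity (\sum_(u | pr (c u)) (4^-1 : R) ^+ k.+1).
  rewrite (partition_big c pr) //= -big_mkcond /=; apply: eq_bigr => w prw.
  rewrite /wt bigA_distr_big_dep; apply: eq_big => [u|u _]; last first.
    by rewrite prodr_const card_ord.
  apply/familyP/andP => [H|[_ /eqP <-] i].
    have -> : c u = w.
      by apply/ffunP => i; apply: val_inj; rewrite ffunE /= inordK // (eqP (H i)).
    by rewrite prw.
  by rewrite unfold_in ffunE /= inordK.
rewrite sumr_const exprVn -[LHS]mulr_natl /nnloop_freq; congr (_%:R * _).
rewrite /num_nnloop -(card_in_imset
  (f := fun u : {ffun 'I_k.+1 -> _} => [tuple u i | i < k.+1])); last first.
  move=> u v _ _ E'; apply/ffunP => i.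
  by have := congr1 (fun t => tnth t i) E'; rewrite !tnth_mktuple.
have prE u : pr (c u) = nnloop (steps [tuple u i | i < k.+1]) k.+1 &&
    (hits (steps [tuple u i | i < k.+1]) k.+1 == 1)%N.
  have E' i : (i < k.+1)%N -> val (c u) i = steps [tuple u i | i < k.+1] i.
    move=> ik; rewrite /val ffunE inordK // /steps; congr ((bits _)%:Z - 1).
    rewrite (nth_mktuple u (false, false) (Ordinal ik)); congr (u _).
    by apply: val_inj; rewrite /= inordK.
  by rewrite /pr (nnloop_ext E') (hits_ext E').
apply: eq_card => w; apply/imsetP/idP => [[u uP ->]|].
  by rewrite inE -prE; apply: uP.
rewrite inE => wP.
have wE : w = [tuple [ffun i => tnth w i] i | i < k.+1].
  by apply: eq_from_tnth => i; rewrite tnth_mktuple ffunE.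
exists [ffun i => tnth w i] => //.
by move: (prE [ffun i => tnth w i]); rewrite -wE wP => prT; exact: prT.
Qed.

End FirstReturn.

Lemma area_tau_eq0_prob :
  P (area_tau_eq0 Y) = (\sum_(k <oo) (nnloop_freq R 1 k.+1)%:E)%E.
Proof.
rewrite area_tau_eq0E measure_semi_bigcup.
- by apply: eq_eseriesr => k _; exact: first_return_prob.
- by move=> k; apply: measurable_first_return.
- exact: trivIset_first_return.
- by apply: bigcupT_measurable => k; apply: measurable_first_return.
Qed.

(** With positive probability the walk begins -1, +1, so that it stops at time 2 with area -1. *)
Lemma area_tau_eq0_lt1 : (P (area_tau_eq0 Y) < 1)%E.
Proof.
pose v (i : nat) : int := if i == 0 then -1 else 1.
pose G := prefix_event 2 (fun i => (v i)%:~R).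
have mG : measurable G by apply: measurable_prefix_event.
have mA : measurable (area_tau_eq0 Y).
  by rewrite area_tau_eq0E; apply: bigcupT_measurable => k; apply: measurable_first_return.
have PG : (0 < P G)%E.
  rewrite /G prefix_event_prob !big_ord_recl big_ord0 mule1 /=.
  case: hY => _ _ H; have [_ p0 _] := H 0%N; have [p1 _ _] := H 1%N.
  rewrite /v /= rmorphN1 p0 (_ : 1%:~R = 1) // p1 -EFinM lte_fin; lra.
have sub : area_tau_eq0 Y `<=` ~` G.
  rewrite area_tau_eq0E => t [k _ [Yk Ak H]] Gt.
  case: k Yk Ak H => [|[|k]] Yk Ak H.
  - by move: Yk; rewrite (walk_height Gt) // => /eqP; rewrite intr_eq0.
  - by move: Ak; rewrite (walk_area Gt) // => /eqP; rewrite intr_eq0.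
  - apply: (H 2%N) => //; rewrite (walk_height Gt) // (walk_area Gt) //; split => //.
    by rewrite lerz0.
apply: (@le_lt_trans _ _ (P (~` G))).
  by apply: le_measure; rewrite ?inE //; apply: measurableC.
rewrite probability_setC // lteBlDr ?fin_num_measure //.
by rewrite -{1}[1%E]adde0 lteD2lE.
Qed.

End Walk.

(** Both sides, multiplied by k + 1, are the same sum over gcds. *)
Lemma num_plane_trees_residue k :
  ((num_plane_trees k.+1).*2 = #|residue_words k.+1|)%N.
Proof.
have := card_orbits k; rewrite -num_plane_trees_orbits -card_residue_words //.
by rewrite -doubleMr doubleMl mulnC => /eqP; rewrite eqn_pmul2l // => /eqP.
Qed.

Lemma omega_partialE (R : realType) n : omega_partial R n =
  2^-1 * \sum_(0 <= k < n) #|residue_words k.+1|%:R / k.+1%:R / 4 ^+ k.+1.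
Proof.
rewrite /omega_partial big_add1 /= mulr_sumr; apply: eq_bigr => k _.
by rewrite -num_plane_trees_residue -mul2n natrM !mulrA mulVf ?mul1r // invfM mulrA.
Qed.

Theorem theorem2 (R : realType) (d : measure_display) (T : measurableType d)
    (P : probability T R) (Y : nat -> {RV P >-> R})
    (hY : lazy_simple_walk Y) :
  cvgn (@omega_partial R) /\ rho Y = 1 - expR (- 2 * omega R).
Proof.
have fin : P (area_tau_eq0 Y) = (rho Y)%:E.
  rewrite /rho fineK // fin_num_measure // area_tau_eq0E.
  by apply: bigcupT_measurable => k; apply: measurable_first_return.
have p0 : 0 <= rho Y by rewrite fine_ge0.
have p1 : rho Y < 1 by rewrite -lte_fin -fin area_tau_eq0_lt1.
have pE := esym (area_tau_eq0_prob hY); rewrite fin in pE.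
have cv : (@omega_partial R) @ \oo --> 2^-1 * - ln (1 - rho Y).
  rewrite (_ : @omega_partial R = fun n => 2^-1 *
    \sum_(0 <= k < n) #|residue_words k.+1|%:R / k.+1%:R / 4 ^+ k.+1).
    exact: cvgMr (cvg_residue_series pE p0 p1).
  by apply/funext => n; apply: omega_partialE.
split; first by apply/cvg_ex; eexists; exact: cv.
rewrite /omega (cvg_lim _ cv) // mulrA mulNr divff // mulN1r opprK lnK ?opprB.
  by rewrite subrKC.
by rewrite posrE subr_gt0.
Qed.
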